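(* Let $X$ be a Banach space and assume that the centralizer $Z(X^{(\infty})$ is infinite-dimensional. Then the $N$-fold projective symmetric tensor product $\widehat{\otimes}_{\pi,s,N}X$ has the strong diameter two property for every $N\in\mathbb N$.
   Context: All Banach spaces are real; $B_X$ and $S_X$ denote the closed unit ball and the unit sphere of $X$. Given a Banach space $X$, let $X^{(2n}$ denote its $2n$-th dual and consider the chain of canonical isometric embeddings $X\subseteq X^{**}\subseteq X^{(4}\subseteq\cdots\subseteq X^{(2n}\subseteq\cdots$. Then $X^{(\infty}$ denotes the completion of the normed space $\bigcup_{n=0}^\infty X^{(2n}$. The centralizer $Z(W)$ of a real Banach space $W$ is the set of multipliers on $W$, i.e. of bounded linear operators $T:W\to W$ such that every extreme point of $B_{W^*}$ is an eigenvector of the adjoint $T^*$. The $N$-fold projective symmetric tensor product $\widehat{\otimes}_{\pi,s,N}X$ is the completion of the $N$-fold symmetric tensor product $\otimes^{s,N}X$ under the norm $\Vert u\Vert:=\inf\{\sum_{i=1}^n|\lambda_i|\Vert x_i\Vert^N: u=\sum_{i=1}^n\lambda_ix_i^N,\ n\in\mathbb N,\ \lambda_i\in\mathbb R,\ x_i\in X\}$, where $x^N=x\otimes\cdots\otimes x$ ($N$ times). A slice of $B_Z$ is a set $\{x\in B_Z: f(x)>1-\alpha\}$ with $f\in S_{Z^*}$ and $\alpha>0$. A Banach space $Z$ has the strong diameter two property (SD2P) if every convex combination of slices of $B_Z$ has diameter two. *)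

(* Defs.v *)
From HB Require Import structures.
From mathcomp Require Import all_boot all_order all_algebra.
From mathcomp Require Import boolp classical_sets functions reals ereal.
From mathcomp Require Import topology normedtype sequences.

Set Implicit Arguments.
Unset Strict Implicit.
Unset Printing Implicit Defensive.

Import Order.TTheory GRing.Theory Num.Theory.
Import numFieldNormedType.Exports.

Local Open Scope classical_set_scope.
Local Open Scope ring_scope.

Section bounded_operators.
Context {R : realType} (E F : normedModType R).

Definition bounded_linear : {pred E -> F} :=
  [pred f : E -> F | `[< linear f /\ continuous f >]].

Lemma bounded_linearE f :
  reflect (linear f /\ continuous f) (f \in bounded_linear).
Proof. by rewrite inE; exact: asboolP. Qed.

Record blin := Blin { blin_fun :> E -> F; _ : blin_fun \in bounded_linear }.

HB.instance Definition _ := [isSub for blin_fun].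
HB.instance Definition _ := [Choice of blin by <:].

Lemma bounded_linear_submod_closed : submod_closed bounded_linear.
Proof.
split.
  apply/bounded_linearE; split.
    by move=> a u v; rewrite [RHS]addr0 scaler0.
  exact: cst_continuous.
move=> a f g /bounded_linearE[lf cf] /bounded_linearE[lg cg].
apply/bounded_linearE; split.
  have fgE x : (a *: f + g) x = a *: f x + g x by [].
  by move=> b u v; rewrite !fgE lf lg !scalerDr !scalerA (mulrC a) addrACA.
by move=> x; apply: cvgD; [apply: cvgZl_tmp; exact: cf | exact: cg].
Qed.

HB.instance Definition _ := GRing.isSubmodClosed.Build R (E -> F)
  bounded_linear bounded_linear_submod_closed.
HB.instance Definition _ := [SubChoice_isSubLmodule of blin by <:].

Lemma blin_linear (f : blin) : linear f.
Proof. by case: f => f /= /bounded_linearE[]. Qed.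

Lemma blin_continuous (f : blin) : continuous f.
Proof. by case: f => f /= /bounded_linearE[]. Qed.

HB.instance Definition _ (f : blin) :=
  GRing.isLinear.Build R E F *:%R f (blin_linear f).

Lemma blinP (f g : blin) : f =1 g -> f = g.
Proof. by move=> fg; apply/val_inj/funext. Qed.

Lemma blinE a (f g : blin) x : (a *: f + g) x = a *: f x + g x.
Proof. by []. Qed.

Definition opnorm (f : blin) : R :=
  sup [set `|f x| | x in [set x : E | `|x| <= 1]].

Lemma opnorm_has_sup (f : blin) :
  has_sup [set `|f x| | x in [set x : E | `|x| <= 1]].
Proof.
split; first by exists `|f 0|, 0 => //=; rewrite normr0.
have /linear_bounded_continuous/bounded_funP/(_ 1)[M fM] := @blin_continuous f.
by exists M => _ [x /= x1 <-]; exact: fM.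
Qed.

Lemma opnorm_ub (f : blin) x : `|x| <= 1 -> `|f x| <= opnorm f.
Proof.
by move=> x1; apply: (sup_upper_bound (opnorm_has_sup f)); exists x.
Qed.

Lemma opnorm_le (f : blin) M :
  (forall x, `|x| <= 1 -> `|f x| <= M) -> opnorm f <= M.
Proof.
move=> fM; apply: ge_sup; first by case: (opnorm_has_sup f).
by move=> _ [x /= x1 <-]; exact: fM.
Qed.

Lemma opnorm_ge0 f : 0 <= opnorm f.
Proof. by rewrite (le_trans _ (@opnorm_ub f 0 _)) ?normr0. Qed.

Lemma ler_opnorm (f : blin) x : `|f x| <= opnorm f * `|x|.
Proof.
have [->|x0] := eqVneq x 0; first by rewrite linear0 !normr0 mulr0.
rewrite -ler_pdivrMr ?normr_gt0// mulrC.
rewrite -[X in X * _]ger0_norm ?invr_ge0// -normrZ -linearZ.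
by apply: opnorm_ub; rewrite normrZ normfV normr_id mulVf ?normr_eq0.
Qed.

Lemma opnormD f g : opnorm (f + g) <= opnorm f + opnorm g.
Proof.
apply: opnorm_le => x x1.
by rewrite (le_trans (ler_normD _ _))// lerD// opnorm_ub.
Qed.

Lemma opnormZ a f : opnorm (a *: f) = `|a| * opnorm f.
Proof.
have le b h : opnorm (b *: h) <= `|b| * opnorm h.
  apply: opnorm_le => x x1; rewrite /= normrZ.
  by rewrite ler_wpM2l// opnorm_ub.
apply/eqP; rewrite eq_le le /=.
have [->|a0] := eqVneq a 0; first by rewrite normr0 mul0r opnorm_ge0.
rewrite -ler_pdivlMl ?normr_gt0// -normfV.
by rewrite -[X in opnorm X <= _](scalerK a0) le.
Qed.

Lemma opnorm0_eq0 f : opnorm f = 0 -> f = 0.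
Proof.
move=> f0; apply: blinP => x; apply/eqP; rewrite -normr_le0.
by rewrite (le_trans (ler_opnorm f x))// f0 mul0r.
Qed.

HB.instance Definition _ :=
  Lmodule_isNormed.Build R blin opnormD opnormZ opnorm0_eq0.

Lemma blin_normE (f : blin) : `|f| = opnorm f. Proof. by []. Qed.

Lemma bounded_linearP (f : E -> F) M :
  linear f -> (forall x, `|f x| <= M * `|x|) -> f \in bounded_linear.
Proof.
move=> lf fM; apply/bounded_linearE; split=> //.
pose h := GRing.isLinear.Build R E F *:%R f lf.
pose g : {linear E -> F} := HB.pack f h.
apply: (@bounded_linear_continuous _ _ _ g).
apply/linear_boundedP; near=> r => x.
rewrite (le_trans (fM x))// ler_wpM2r//.
by near: r; apply: nbhs_pinfty_ge; exact: num_real.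
Unshelve. all: by end_near. Qed.

End bounded_operators.

Definition dual {R : realType} (E : normedModType R) : normedModType R :=
  blin E R^o.

Section canonical_embedding.
Context {R : realType} {E : normedModType R}.

Definition bidual_eval (x : E) : dual E -> R^o := fun f => f x.

Lemma bidual_eval_subproof x : bidual_eval x \in @bounded_linear R (dual E) R^o.
Proof.
apply: (@bounded_linearP _ _ _ _ `|x|) => [a f g //|f].
by rewrite mulrC; exact: ler_opnorm.
Qed.

Definition bidual_embed (x : E) : dual (dual E) :=
  Blin (bidual_eval_subproof x).

Lemma bidual_embed_linear : linear bidual_embed.
Proof. by move=> a x y; apply: blinP => f; exact: linearP. Qed.

Lemma bidual_embed_le x : `|bidual_embed x| <= `|x|.
Proof.
apply: opnorm_le => f f1; rewrite (le_trans (ler_opnorm f x))//.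
by rewrite ler_piMl.
Qed.

End canonical_embedding.

Section adjoint.
Context {R : realType} {E F : normedModType R}.

Lemma adjoint_subproof (T : blin E F) (f : dual F) :
  f \o T \in @bounded_linear R E R^o.
Proof.
apply/bounded_linearE; split; first by move=> a u v /=; rewrite !linearP.
by move=> x; apply: continuous_comp; exact: blin_continuous.
Qed.

Definition adjoint (T : blin E F) (f : dual F) : dual E :=
  Blin (adjoint_subproof T f).

End adjoint.

Section centralizer.
Context {R : realType}.

Definition extreme_point (V : lmodType R) (A : set V) : set V :=
  [set p | A p /\ forall x y (t : R), A x -> A y -> 0 < t < 1 ->
     p = t *: x + (1 - t) *: y -> x = p /\ y = p].

Definition eigenvector (V : lmodType R) (S : V -> V) (p : V) :=
  p != 0 /\ exists a : R, S p = a *: p.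

Definition unit_ball (E : normedModType R) : set E := [set x | `|x| <= 1].

(* For W != 0 the extreme points of the dual ball are nonzero; for W = 0 both
   readings of "eigenvector" give a finite-dimensional centralizer. *)
Definition centralizer (W : normedModType R) : set (blin W W) :=
  [set T | forall p, extreme_point (@unit_ball (dual W)) p ->
     eigenvector (adjoint T) p].

Definition finite_dimensional (V : lmodType R) (A : set V) :=
  exists n (e : 'I_n -> V), forall v, A v ->
    exists c : 'I_n -> R, v = \sum_(i < n) c i *: e i.

End centralizer.

Arguments centralizer {R} W.

Section SD2P.
Context {R : realType} (Z : normedModType R).

Definition slice (f : dual Z) (alpha : R) : set Z :=
  [set x | unit_ball x /\ 1 - alpha < f x].

Definition is_slice (S : set Z) :=
  exists (f : dual Z) (alpha : R), [/\ `|f| = 1, 0 < alpha & S = slice f alpha].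

Definition convex_combination n (lambda : 'I_n -> R) (S : 'I_n -> set Z) :
    set Z :=
  [set \sum_(i < n) lambda i *: x i |
    x in [set x : 'I_n -> Z | forall i, S i (x i)]].

Definition diameter (A : set Z) : \bar R :=
  ereal_sup [set `|x - y|%:E | x in A & y in A].

Definition SD2P := forall n (lambda : 'I_n -> R) (S : 'I_n -> set Z),
  (forall i, 0 <= lambda i) -> \sum_(i < n) lambda i = 1 ->
  (forall i, is_slice (S i)) ->
  diameter (convex_combination lambda S) = 2%:E.

End SD2P.

(* The Hausdorff completion of a vector space V under a seminorm p: Cauchy
   sequences in V modulo those on which p tends to 0, with the norm lim p.  It
   is the usual completion when p is a norm; starting from a seminorm spares
   the definiteness proofs, which rely on the Hahn-Banach theorem in the
   applications below. *)
Record seminorm (R : realType) (V : lmodType R) := Seminorm {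
  seminorm_fun :> V -> R;
  seminormD : forall x y,
    seminorm_fun (x + y) <= seminorm_fun x + seminorm_fun y;
  seminormZ : forall a x, seminorm_fun (a *: x) = `|a| * seminorm_fun x }.

Section seminorm_theory.
Context {R : realType} {V : lmodType R} (p : seminorm V).

Lemma seminorm0 : p 0 = 0.
Proof. by rewrite -(scale0r 0) seminormZ normr0 mul0r. Qed.

Lemma seminormN x : p (- x) = p x.
Proof. by rewrite -scaleN1r seminormZ normrN1 mul1r. Qed.

Lemma seminormB x y : p (x - y) = p (y - x).
Proof. by rewrite -seminormN opprB. Qed.

Lemma seminorm_ge0 x : 0 <= p x.
Proof.
have := seminormD p x (- x); rewrite subrr seminorm0 seminormN -mulr2n.
by rewrite pmulrn_lge0.
Qed.

Lemma seminorm_tri x y z : p (x - z) <= p (x - y) + p (y - z).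
Proof. by rewrite (le_trans _ (seminormD _ _ _))// addrA subrK. Qed.

Lemma seminorm_dist x y : `|p x - p y| <= p (x - y).
Proof.
have le a b : p a - p b <= p (a - b).
  by rewrite lerBlDr (le_trans _ (seminormD _ _ _))// subrK.
by rewrite ler_norml lerNl opprB {1}seminormB !le.
Qed.

End seminorm_theory.

Section completion.
Context {R : realType} {V : lmodType R} (p : seminorm V).

Definition cauchy_seq : {pred nat -> V} :=
  [pred u | `[< forall e : R, 0 < e -> exists n0 : nat,
      forall m n : nat, (n0 <= m)%N -> (n0 <= n)%N -> p (u m - u n) <= e >]].

Lemma cauchy_seqP u : reflect
  (forall e : R, 0 < e -> exists n0 : nat,
      forall m n : nat, (n0 <= m)%N -> (n0 <= n)%N -> p (u m - u n) <= e)
  (u \in cauchy_seq).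
Proof. by rewrite inE; exact: asboolP. Qed.

Record cauchySeq := CauchySeq {
  cauchy_val :> nat -> V; _ : cauchy_val \in cauchy_seq }.

HB.instance Definition _ := [isSub for cauchy_val].
HB.instance Definition _ := [Choice of cauchySeq by <:].

Lemma cauchy_seq_submod_closed : submod_closed cauchy_seq.
Proof.
split.
  by apply/cauchy_seqP => e e0; exists 0%N => m n _ _; rewrite subrr seminorm0 ltW.
move=> a u v /cauchy_seqP cu /cauchy_seqP cv; apply/cauchy_seqP => e e0.
have a1 : 0 < `|a| + 1 by rewrite ltr_wpDl.
have [n1 {}cu] := cu (e / 2 / (`|a| + 1)) (divr_gt0 (divr_gt0 e0 (ltr0Sn R 1)) a1).
have [n2 {}cv] := cv (e / 2) (divr_gt0 e0 (ltr0Sn R 1)).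
exists (maxn n1 n2) => m n; rewrite !geq_max => /andP[m1 m2] /andP[n1' n2'].
rewrite [X in p X](_ : _ = a *: (u m - u n) + (v m - v n)); last first.
  by rewrite scalerBr addrACA -opprD.
rewrite (le_trans (seminormD _ _ _))// seminormZ (splitr e) lerD ?cv//.
rewrite (le_trans (ler_wpM2l _ (cu m n m1 n1')))//.
rewrite mulrCA ger_pMr ?divr_gt0// ler_pdivrMr// mul1r.
by rewrite lerDl.
Qed.

HB.instance Definition _ := GRing.isSubmodClosed.Build R (nat -> V)
  cauchy_seq cauchy_seq_submod_closed.
HB.instance Definition _ := [SubChoice_isSubLmodule of cauchySeq by <:].

Lemma is_cvg_seminorm (u : cauchySeq) : cvgn (fun n => p (u n)).
Proof.
apply: cauchy_cvg; apply/cauchy_exP => e e0.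
case: u => u /= /cauchy_seqP/(_ (e / 2) (divr_gt0 e0 (ltr0Sn R 1)))[n0 cu].
exists (p (u n0)); exists n0 => // n /= n0n.
rewrite /= -ball_normE /= (le_lt_trans (seminorm_dist _ _ _))//.
by rewrite (le_lt_trans (cu _ _ _ _))// ltr_pdivrMr// ltr_pMr// ltr1n.
Qed.

Definition lim_seminorm (u : cauchySeq) : R := limn (fun n => p (u n)).

Lemma lim_seminormD u v : lim_seminorm (u + v) <= lim_seminorm u + lim_seminorm v.
Proof.
rewrite /lim_seminorm -limD; [|exact: is_cvg_seminorm..].
apply: ler_lim; [exact: is_cvg_seminorm|by apply: is_cvgD; exact: is_cvg_seminorm|].
by near=> n; exact: seminormD.
Unshelve. all: by end_near. Qed.

Lemma lim_seminormZ a u : lim_seminorm (a *: u) = `|a| * lim_seminorm u.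
Proof.
apply: cvg_lim => //.
rewrite [X in X @ _ --> _](_ : _ = fun n => `|a| * p (u n)); last first.
  by apply/funext => n; rewrite -seminormZ.
by apply: cvgMl_tmp; exact: is_cvg_seminorm.
Qed.

Definition lim_seminorm_seminorm := Seminorm lim_seminormD lim_seminormZ.
Local Notation q := lim_seminorm_seminorm.

Definition null_seq : {pred cauchySeq} := [pred u | lim_seminorm u == 0].

Lemma null_seq_zmod_closed : zmod_closed null_seq.
Proof.
split; first by rewrite inE; apply/eqP/(seminorm0 q).
move=> u v; rewrite !inE => /eqP u0 /eqP v0; rewrite eq_le.
have := seminormD q u (- v); rewrite seminormN /= u0 v0 addr0 => -> /=.
exact: (seminorm_ge0 q).
Qed.

HB.instance Definition _ :=
  GRing.isZmodClosed.Build cauchySeq null_seq null_seq_zmod_closed.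

Definition completion := Quotient.quot null_seq.
HB.instance Definition _ := GRing.Zmodule.on completion.

Local Open Scope quotient_scope.
Local Notation pi := (\pi_completion : cauchySeq -> completion).

Lemma completion_eqP (u v : cauchySeq) :
  reflect (pi u = pi v) (lim_seminorm (u - v) == 0).
Proof. by have := @Quotient.idealrBE _ null_seq u v; rewrite inE => ->; exact: eqP. Qed.

Definition completion_scale (a : R) (x : completion) : completion :=
  pi (a *: repr x).

Lemma completion_piZ a u : completion_scale a (pi u) = pi (a *: u).
Proof.
apply/completion_eqP; rewrite -scalerBr lim_seminormZ mulf_eq0; apply/orP; right.
by apply/completion_eqP; rewrite reprK.
Qed.

Lemma completion_piD u v : pi (u + v) = pi u + pi v.
Proof. by rewrite !piE. Qed.

Lemma completion_scaleA a b x :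
  completion_scale a (completion_scale b x) = completion_scale (a * b) x.
Proof. by rewrite -(reprK x) (completion_piZ b) !completion_piZ scalerA. Qed.
Lemma completion_scale1 : left_id 1 completion_scale.
Proof. by move=> x; rewrite -(reprK x) completion_piZ scale1r. Qed.
Lemma completion_scaleDr : right_distributive completion_scale +%R.
Proof.
move=> a x y; rewrite -(reprK x) -(reprK y) -completion_piD !completion_piZ.
by rewrite scalerDr completion_piD.
Qed.
Lemma completion_scaleDl x : {morph completion_scale^~ x : a b / a + b}.
Proof.
by move=> a b; rewrite -(reprK x) !completion_piZ scalerDl completion_piD.
Qed.

HB.instance Definition _ := GRing.Zmodule_isLmodule.Build R completion
  completion_scaleA completion_scale1 completion_scaleDr completion_scaleDl.

Definition completion_norm (x : completion) : R := lim_seminorm (repr x).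

Lemma completion_normE u : completion_norm (pi u) = lim_seminorm u.
Proof.
apply/eqP; rewrite -subr_eq0 -normr_le0.
rewrite (le_trans (seminorm_dist q _ _))//=.
suff /eqP -> : lim_seminorm (repr (pi u) - u) == 0 by [].
by apply/completion_eqP; rewrite reprK.
Qed.

Lemma completion_normD x y :
  completion_norm (x + y) <= completion_norm x + completion_norm y.
Proof.
rewrite -(reprK x) -(reprK y) -completion_piD !completion_normE.
exact: lim_seminormD.
Qed.
Lemma completion_normZ a (x : completion) :
  completion_norm (a *: x) = `|a| * completion_norm x.
Proof.
by rewrite -{1}(reprK x) [_ *: _]completion_piZ completion_normE lim_seminormZ.
Qed.
Lemma completion_norm0_eq0 x : completion_norm x = 0 -> x = 0.
Proof.
rewrite -(reprK x) completion_normE => u0.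
rewrite -[RHS](_ : pi 0 = 0) ?piE//; apply/completion_eqP.
by rewrite subr0 u0.
Qed.

HB.instance Definition _ :=
  Lmodule_isNormed.Build R completion completion_normD completion_normZ completion_norm0_eq0.

Lemma completion_pi_norm u : `|pi u| = lim_seminorm u.
Proof. exact: completion_normE. Qed.

Lemma cst_cauchy (v : V) : (fun=> v) \in cauchy_seq.
Proof.
by apply/cauchy_seqP => e e0; exists 0%N => m n _ _; rewrite subrr seminorm0 ltW.
Qed.

Definition completion_embed (v : V) : completion := pi (CauchySeq (cst_cauchy v)).

Lemma completion_embed_linear : linear completion_embed.
Proof.
move=> a u v; rewrite /completion_embed [_ *: pi _]completion_piZ -completion_piD.
by congr pi; exact: val_inj.
Qed.

Lemma completion_embed_norm v : `|completion_embed v| = p v.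
Proof.
by rewrite completion_pi_norm /lim_seminorm /= lim_cst.
Qed.

Lemma completion_embedB u v :
  completion_embed u - completion_embed v = completion_embed (u - v).
Proof.
by have := completion_embed_linear (-1) v u; rewrite !scaleN1r ![- _ + _]addrC.
Qed.

Lemma completion_embed_lim (u : cauchySeq) :
  (fun n => completion_embed (u n)) @ \oo --> pi u.
Proof.
apply/cvgrPdist_le => e e0.
have := valP u => /cauchy_seqP/(_ _ e0)[n0 cu].
exists n0 => // n /= n0n.
rewrite /completion_embed -[_ - _](_ : pi (u - CauchySeq (cst_cauchy (u n))) = _); last first.
  by rewrite !piE.
rewrite completion_pi_norm; apply: limr_le; first exact: is_cvg_seminorm.
by exists n0 => // m /= n0m; exact: cu.
Qed.

Lemma completion_embed_dense : closure (range completion_embed) = setT.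
Proof.
apply/seteqP; split => // x _ A; rewrite -{1}(reprK x) => xA.
have [n0 _ /(_ n0 (leqnn _)) An0] := completion_embed_lim xA.
by exists (completion_embed (repr x n0)); split => //; exists (repr x n0).
Qed.

Lemma completion_complete (F : set_system completion) :
  ProperFilter F -> cauchy F -> cvg F.
Proof.
move=> FF /cauchyP Fc.
have /choice[v Fv] n : exists v, F (ball (completion_embed v) n.+1%:R^-1).
  have n2 : 0 < n.+1%:R^-1 / 2 :> R by rewrite divr_gt0.
  have [x Fx] := Fc _ n2.
  have /(_ (ball x (n.+1%:R^-1 / 2)) (nbhsx_ballx _ _ n2))[_ [[v _ <-] xv]] :
    closure (range completion_embed) x by rewrite completion_embed_dense.
  exists v; apply: filterS Fx => y xy.
  by rewrite [n.+1%:R^-1]splitr; apply: ball_triangle xy; exact: ball_sym.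
have small (e : R) : 0 < e -> \forall n \near \oo, n.+1%:R^-1 < e.
  by move=> e0; exact: near_infty_natSinv_lt (PosNum e0).
have cv : v \in cauchy_seq.
  apply/cauchy_seqP => e e0.
  have [n0 _ n0e] := small (e / 2) (divr_gt0 e0 (ltr0Sn R 1)).
  exists n0 => m n n0m n0n.
  have [y [my ny]] := filter_ex (filterI (Fv m) (Fv n)).
  rewrite -completion_embed_norm -completion_embedB.
  rewrite -ball_normE /= in my; rewrite -ball_normE /= distrC in ny.
  rewrite (splitr e) (le_trans (ler_distD y _ _))// lerD//.
    by rewrite ltW// (lt_trans my)// n0e.
  by rewrite ltW// (lt_trans ny)// n0e.
apply/cvg_ex; exists (pi (CauchySeq cv)); apply/cvgrPdist_le => e e0.
have e2 : 0 < e / 2 by rewrite divr_gt0.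
have [n [ne vn]] : exists n, n.+1%:R^-1 < e / 2 /\
    `|pi (CauchySeq cv) - completion_embed (v n)| <= e / 2.
  have /cvgrPdist_le/(_ _ e2) := @completion_embed_lim (CauchySeq cv).
  by move=> /(filterI (small _ e2))/filter_ex.
apply: filterS (Fv n) => y; rewrite -ball_normE /= => vy.
rewrite (splitr e) (le_trans (ler_distD (completion_embed (v n)) _ _))// lerD//.
by rewrite ltW// (lt_trans vy).
Qed.

HB.instance Definition _ := Uniform_isComplete.Build completion completion_complete.

End completion.

(* The union of the chain X in X** in X^(4 in ... is presented by sequences
   s_n in X^(2n which are eventually constant along the canonical embeddings:
   such a sequence represents the common value of its tail, so the norm of the
   union is the limit of the norms, and two sequences represent the same element
   if and only if their difference has seminorm zero. *)
Section infinite_dual.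
Context {R : realType} (X : normedModType R).

Fixpoint even_dual (n : nat) : normedModType R :=
  if n is m.+1 then dual (dual (even_dual m)) else X.

Definition dual_family : Type := forall n, even_dual n.

HB.instance Definition _ := gen_eqMixin dual_family.
HB.instance Definition _ := gen_choiceMixin dual_family.

Definition dual_family_zero : dual_family := fun=> 0.
Definition dual_family_opp (s : dual_family) : dual_family := fun n => - s n.
Definition dual_family_add (s t : dual_family) : dual_family :=
  fun n => s n + t n.
Definition dual_family_scale (a : R) (s : dual_family) : dual_family :=
  fun n => a *: s n.

Lemma dual_family_addA : associative dual_family_add.
Proof. by move=> s t w; apply: functional_extensionality_dep => n; exact: addrA. Qed.
Lemma dual_family_addC : commutative dual_family_add.
Proof. by move=> s t; apply: functional_extensionality_dep => n; exact: addrC. Qed.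
Lemma dual_family_add0 : left_id dual_family_zero dual_family_add.
Proof. by move=> s; apply: functional_extensionality_dep => n; exact: add0r. Qed.
Lemma dual_family_addN :
  left_inverse dual_family_zero dual_family_opp dual_family_add.
Proof. by move=> s; apply: functional_extensionality_dep => n; exact: addNr. Qed.

HB.instance Definition _ :=
  GRing.isZmodule.Build dual_family
    dual_family_addA dual_family_addC dual_family_add0 dual_family_addN.

Lemma dual_family_scaleA a b s :
  dual_family_scale a (dual_family_scale b s) = dual_family_scale (a * b) s.
Proof. by apply: functional_extensionality_dep => n; exact: scalerA. Qed.
Lemma dual_family_scale1 : left_id 1 dual_family_scale.
Proof. by move=> s; apply: functional_extensionality_dep => n; exact: scale1r. Qed.
Lemma dual_family_scaleDr : right_distributive dual_family_scale +%R.
Proof. by move=> a s t; apply: functional_extensionality_dep => n; exact: scalerDr. Qed.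
Lemma dual_family_scaleDl s : {morph dual_family_scale^~ s : a b / a + b}.
Proof. by move=> a b; apply: functional_extensionality_dep => n; exact: scalerDl. Qed.

HB.instance Definition _ :=
  GRing.Zmodule_isLmodule.Build R dual_family dual_family_scaleA
    dual_family_scale1 dual_family_scaleDr dual_family_scaleDl.

Definition eventually_embedded : {pred dual_family} := [pred s : dual_family |
  `[< exists m, forall n, (m <= n)%N -> s n.+1 = bidual_embed (s n) >]].

Lemma eventually_embeddedP s : reflect
  (exists m, forall n, (m <= n)%N -> s n.+1 = bidual_embed (s n))
  (s \in eventually_embedded).
Proof. by rewrite inE; exact: asboolP. Qed.

Lemma eventually_embedded_submod_closed : submod_closed eventually_embedded.
Proof.
split.
  apply/eventually_embeddedP; exists 0%N => n _.
  by apply/esym/blinP => f; exact: (linear0 f).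
move=> a s t /eventually_embeddedP[m sm] /eventually_embeddedP[k tk].
apply/eventually_embeddedP; exists (maxn m k) => n.
rewrite geq_max => /andP[mn kn].
have E j : (a *: s + t) j = a *: s j + t j by [].
by rewrite !E bidual_embed_linear sm// tk.
Qed.

Record dual_union :=
  DualUnion { dual_union_val :> dual_family;
              _ : dual_union_val \in eventually_embedded }.

HB.instance Definition _ := [isSub for dual_union_val].
HB.instance Definition _ := [Choice of dual_union by <:].
HB.instance Definition _ := GRing.isSubmodClosed.Build R dual_family
  eventually_embedded eventually_embedded_submod_closed.
HB.instance Definition _ := [SubChoice_isSubLmodule of dual_union by <:].

Definition union_norm (s : dual_union) : R := limn (fun n => `|dual_union_val s n|).

Lemma is_cvg_union_norm (s : dual_union) : cvgn (fun n => `|dual_union_val s n|).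
Proof.
have /eventually_embeddedP[m sm] := valP s.
suff /cvg_ex[l] : cvgn [sequence `|dual_union_val s (n + m)%N|]_n.
  by rewrite (cvg_shiftn m (fun n => `|dual_union_val s n|) (nbhs l)) => /cvgP.
apply: nonincreasing_is_cvgn.
  apply/nonincreasing_seqP => n /=.
  have sE := congr1 (fun x : even_dual (n + m).+1 => `|x|) (sm _ (leq_addl n m)).
  rewrite [leLHS](sE : _ = `|bidual_embed (dual_union_val s (n + m)%N)|).
  exact: bidual_embed_le.
by exists 0 => _ [n _ <-]; exact: normr_ge0.
Qed.

Lemma union_normD s t : union_norm (s + t) <= union_norm s + union_norm t.
Proof.
rewrite /union_norm -limD; [|exact: is_cvg_union_norm..].
apply: ler_lim; [exact: is_cvg_union_norm|by apply: is_cvgD; exact: is_cvg_union_norm|].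
by near=> n; exact: ler_normD.
Unshelve. all: by end_near. Qed.

Lemma union_normZ a s : union_norm (a *: s) = `|a| * union_norm s.
Proof.
apply: cvg_lim => //.
rewrite [X in X @ _ --> _](_ : _ = fun n => `|a| * `|dual_union_val s n|); last first.
  by apply/funext => n; rewrite -normrZ.
by apply: cvgMl_tmp; exact: is_cvg_union_norm.
Qed.

Definition union_seminorm := Seminorm union_normD union_normZ.

Definition infinite_dual : completeNormedModType R :=
  completion union_seminorm.

(* The canonical map of X^(2k into the completion, through the sequence that is
   0 before k and J_{n-1} ... J_k x from k on. *)
Fixpoint embedded_tail k (x : even_dual k) n : even_dual n :=
  if n is m.+1 then
    if k == m.+1 then dfwith dual_family_zero x m.+1
    else bidual_embed (embedded_tail x m)
  else dfwith dual_family_zero x 0.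

Lemma embedded_tail_id k (x : even_dual k) : embedded_tail x k = x.
Proof. by case: k x => [|k] x /=; rewrite ?eqxx dfwith_in. Qed.

Lemma embedded_tailS k (x : even_dual k) n : (k <= n)%N ->
  embedded_tail x n.+1 = bidual_embed (embedded_tail x n).
Proof. by move=> kn /=; rewrite ltn_eqF. Qed.

Lemma embedded_tailP k (x : even_dual k) :
  (embedded_tail x : dual_family) \in eventually_embedded.
Proof. by apply/eventually_embeddedP; exists k => n; exact: embedded_tailS. Qed.

Definition even_dual_embed k (x : even_dual k) : infinite_dual :=
  completion_embed union_seminorm (DualUnion (embedded_tailP x)).

Lemma even_dual_embed_tail (s : dual_union) k :
  (forall n, (k <= n)%N ->
    dual_union_val s n.+1 = bidual_embed (dual_union_val s n)) ->
  completion_embed union_seminorm s = even_dual_embed (dual_union_val s k).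
Proof.
move=> sk; apply/eqP; rewrite -subr_eq0 -normr_eq0 completion_embedB.
rewrite completion_embed_norm; apply/eqP/cvg_lim => //.
apply: cvg_near_cst; exists k => // n /= kn.
change (`|dual_union_val s n - embedded_tail (dual_union_val s k) n| = 0).
apply/eqP; rewrite normr_eq0 subr_eq0; apply/eqP.
elim: n kn => [|n IHn]; first by rewrite leqn0 => /eqP ->; rewrite embedded_tail_id.
rewrite leq_eqVlt => /predU1P[<-|kn]; first by rewrite embedded_tail_id.
by rewrite embedded_tailS// sk// IHn.
Qed.

Lemma even_dual_embedS k (x : even_dual k) :
  even_dual_embed (bidual_embed x : even_dual k.+1) = even_dual_embed x.
Proof.
rewrite {2}/even_dual_embed (@even_dual_embed_tail _ k.+1).
  by rewrite [dual_union_val _ _]embedded_tailS// embedded_tail_id.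
by move=> n kn; exact: embedded_tailS (ltnW kn).
Qed.

Lemma even_dual_embed_dense :
  closure (\bigcup_k range (@even_dual_embed k)) = setT.
Proof.
apply/seteqP; split => // y _.
have : closure (range (completion_embed union_seminorm)) y.
  by rewrite completion_embed_dense.
apply: closure_subset => _ [s _ <-].
have /eventually_embeddedP[k sk] := valP s.
by exists k => //; exists (dual_union_val s k) => //; rewrite -(even_dual_embed_tail sk).
Qed.

End infinite_dual.

(* As usual for algebraic tensor products over a field, the tensor
   x_1 (x) ... (x) x_N is the functional A |-> A(x_1, ..., x_N) on the space of
   N-linear forms on X. *)
Section symmetric_tensors.
Context {R : realType} (N : nat) (X : normedModType R).

Definition multilinear (A : ('I_N -> X) -> R) :=
  forall (i : 'I_N) (x : 'I_N -> X) (a : R) (u v : X),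
    A (dfwith x (i := i) (a *: u + v)) =
    a * A (dfwith x (i := i) u) + A (dfwith x (i := i) v).

Record multilinear_form := MultilinearForm {
  multilinear_form_val :> ('I_N -> X) -> R;
  _ : multilinear multilinear_form_val }.

Definition tensor (x : 'I_N -> X) : multilinear_form -> R^o := fun A => A x.

Definition tensor_power (x : X) := tensor (fun=> x).

Definition tensor_sum (s : seq (R * X)) : multilinear_form -> R^o :=
  \sum_(a <- s) a.1 *: tensor_power a.2.

Definition symmetric_tensor : {pred multilinear_form -> R^o} :=
  [pred u | `[< exists s, u = tensor_sum s >]].

Lemma symmetric_tensorP u :
  reflect (exists s, u = tensor_sum s) (u \in symmetric_tensor).
Proof. by rewrite inE; exact: asboolP. Qed.

Definition scale_rep (a : R) (s : seq (R * X)) := [seq (a * b.1, b.2) | b <- s].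

Lemma tensor_sumZ a s : tensor_sum (scale_rep a s) = a *: tensor_sum s.
Proof.
rewrite /tensor_sum big_map scaler_sumr.
by apply: eq_bigr => b _; rewrite scalerA.
Qed.

Lemma tensor_sumD s t : tensor_sum (s ++ t) = tensor_sum s + tensor_sum t.
Proof. by rewrite /tensor_sum big_cat. Qed.

Lemma symmetric_tensor_submod_closed : submod_closed symmetric_tensor.
Proof.
split; first by apply/symmetric_tensorP; exists [::]; rewrite /tensor_sum big_nil.
move=> a u v /symmetric_tensorP[s ->] /symmetric_tensorP[t ->].
apply/symmetric_tensorP; exists (scale_rep a s ++ t).
by rewrite tensor_sumD tensor_sumZ.
Qed.

Record symTensor :=
  SymTensor { symTensor_val :> multilinear_form -> R^o;
              _ : symTensor_val \in symmetric_tensor }.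

HB.instance Definition _ := [isSub for symTensor_val].
HB.instance Definition _ := [Choice of symTensor by <:].
HB.instance Definition _ := GRing.isSubmodClosed.Build R (multilinear_form -> R^o)
  symmetric_tensor symmetric_tensor_submod_closed.
HB.instance Definition _ := [SubChoice_isSubLmodule of symTensor by <:].

Definition rep_cost (s : seq (R * X)) : R := \sum_(a <- s) `|a.1| * `|a.2| ^+ N.

Definition proj_norm (u : symTensor) : R :=
  inf [set rep_cost s | s in
    [set s | u = tensor_sum s :> (multilinear_form -> R^o)]].

Lemma rep_cost_ge0 s : 0 <= rep_cost s.
Proof. by apply: sumr_ge0 => a _; rewrite mulr_ge0// exprn_ge0. Qed.

Lemma rep_costD s t : rep_cost (s ++ t) = rep_cost s + rep_cost t.
Proof. by rewrite /rep_cost big_cat. Qed.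

Lemma rep_costZ a s : rep_cost (scale_rep a s) = `|a| * rep_cost s.
Proof.
rewrite /rep_cost big_map mulr_sumr.
by apply: eq_bigr => b _; rewrite normrM mulrA.
Qed.

Lemma proj_norm_has_inf (u : symTensor) :
  has_inf [set rep_cost s | s in
    [set s | u = tensor_sum s :> (multilinear_form -> R^o)]].
Proof.
split; last by exists 0 => _ [s _ <-]; exact: rep_cost_ge0.
by have /symmetric_tensorP[s us] := valP u; exists (rep_cost s), s.
Qed.

Lemma proj_norm_lb (u : symTensor) s :
  u = tensor_sum s :> (multilinear_form -> R^o) -> proj_norm u <= rep_cost s.
Proof. by move=> us; apply: (ge_inf (proj_norm_has_inf u).2); exists s. Qed.

Lemma proj_norm_ge (u : symTensor) r :
  (forall s, u = tensor_sum s :> (multilinear_form -> R^o) -> r <= rep_cost s) ->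
  r <= proj_norm u.
Proof.
move=> ur; apply: lb_le_inf (proj_norm_has_inf u).1 _ => _ [s us <-].
exact: ur.
Qed.

Lemma proj_normD u v : proj_norm (u + v) <= proj_norm u + proj_norm v.
Proof.
rewrite -lerBlDr; apply: proj_norm_ge => s us.
rewrite lerBlDr [leRHS]addrC -lerBlDr; apply: proj_norm_ge => t vt.
by rewrite lerBlDr [leRHS]addrC -rep_costD proj_norm_lb//= tensor_sumD us vt.
Qed.

Lemma proj_normZ a u : proj_norm (a *: u) = `|a| * proj_norm u.
Proof.
have le b w : proj_norm (b *: w) <= `|b| * proj_norm w.
  have [->|b0] := eqVneq b 0.
    rewrite scale0r normr0 mul0r (le_trans (@proj_norm_lb _ [::] _))//.
      by rewrite /= /tensor_sum big_nil.
    by rewrite /rep_cost big_nil.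
  rewrite -ler_pdivrMl ?normr_gt0//; apply: proj_norm_ge => s ws.
  rewrite ler_pdivrMl ?normr_gt0// -rep_costZ proj_norm_lb//.
  by rewrite tensor_sumZ -ws.
apply/eqP; rewrite eq_le le /=.
have [->|a0] := eqVneq a 0.
  rewrite normr0 mul0r; apply: proj_norm_ge => s _; exact: rep_cost_ge0.
by rewrite -ler_pdivlMl ?normr_gt0// -normfV -[X in proj_norm X <= _](scalerK a0) le.
Qed.

Definition proj_seminorm := Seminorm proj_normD proj_normZ.

Definition proj_sym_tensor_product : completeNormedModType R :=
  completion proj_seminorm.

End symmetric_tensors.

(* Main.v *)
Require Import Defs.
From HB Require Import structures.
From mathcomp Require Import all_boot all_order all_algebra.
From mathcomp Require Import boolp classical_sets functions reals ereal.
From mathcomp Require Import topology normedtype sequences.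
From mathcomp Require Import ring lra.

Set Implicit Arguments.
Unset Strict Implicit.
Unset Printing Implicit Defensive.

Import Order.TTheory GRing.Theory Num.Theory.
Import numFieldNormedType.Exports.

Local Open Scope classical_set_scope.
Local Open Scope ring_scope.

(** The function [x |-> f (x (x) ... (x) x)] attached to a functional [f] on the
    symmetric tensor product is an [N]-homogeneous polynomial on [X], and the
    norm of [f] is the supremum of its modulus on the ball.  To find two points of
    a convex combination of slices at distance almost two it is therefore enough
    to move almost maximal points [x_i] of finitely many polynomials [P_i] to
    points [y_i], [z_i] of the ball at which the [P_i] still have almost the same
    value and which can be told apart, uniformly in [i], by two functionals:
    [phi y_i], [phi z_i] and [psi y_i] are almost [1] while [psi z_i] is almost
    [-1].  The product form [psi (x) phi (x) ... (x) phi] then takes values of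
    opposite sign, almost [1] and [-1], on the two points of the combination,
    and the projective norm dominates it ([power_sum_norm_ge]).

    Let [W] be the completed union of the even duals. If its centralizer is
    infinite-dimensional, it provides such moves in [W] ([peaked_perturbations]).
    A multiplier acts at every extreme point of the dual ball as a scalar, and
    extreme points norm [W] ([extreme_norming]), so multipliers behave as scalar
    functions. Since they span an infinite-dimensional space, one of them takes
    the values [0], ..., [n-1] at some extreme points ([separating_multiplier]),
    and polynomials in it give a family of nonnegative functions with sum at most
    [1], each almost [1] somewhere ([peak_multipliers]). Multiplying [x] by [1 - h
    - h'] and adding [h w] and [h' w'], or [h w] and [- h' w'], for two functions
    [h], [h'] of the family does not leave the ball, whatever [x] is, and fixes
    the values at two extreme points. Moreover many such moves can be made
    simultaneously.

    This independence is what keeps the polynomials under control. For points [x +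
    sum_(j in S) b_j] of the ball indexed by all subsets [S] of a large set, the
    sum over [j] of the increments [P (x + b_j) - P x] is bounded by a constant
    depending on the degree only ([cube_slope_bound]). When all [P_i] are, up to a
    sign, almost maximal at [x_i], no increment can be significantly positive, so
    most increments are small for all [i] at once. This is a finite form of the
    weak sequential continuity of polynomials on [c_0].

    Finally the centralizer lives on the union of the even duals and not on [X].
    The moves form a finite system of strict inequalities between norms, together
    with finitely many values of functionals, and such systems descend from a
    bidual to the space ([helly_goldstine], [finitely_represented_bidual]), hence
    from [W] to [X] ([finitely_represented_infinite_dual]).  Polynomials are
    evaluated on [X] only. *)

(** * Extreme supports of sublinear functions *)

Section extreme_support.
Context {R : realType} {V : lmodType R}.
Implicit Types (p q : V -> R) (f g : V -> R^o).

Definition sublinear p :=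
  (forall x y, p (x + y) <= p x + p y) /\
  (forall a x, 0 < a -> p (a *: x) = a * p x).

(** A weak-star closed convex set of functionals corresponds to its support
    function.  Under this dictionary [q] is a face of the set of linear
    functionals below [p]; no topology on the functionals is involved. *)
Definition supporting_face p q :=
  [/\ sublinear q, forall x, q x <= p x &
    forall f g (t : R), linear f -> linear g ->
      (forall x, f x <= p x) -> (forall x, g x <= p x) -> 0 < t < 1 ->
      (forall x, t * f x + (1 - t) * g x <= q x) ->
    (forall x, f x <= q x) /\ (forall x, g x <= q x)].

Lemma sublinear0 q : sublinear q -> q 0 = 0.
Proof.
case=> _ /(_ 2 0 (ltr0Sn R 1)); rewrite scaler0 => /eqP.
by rewrite -subr_eq0 => /eqP q0; lra.
Qed.

Lemma sublinear_geN q x : sublinear q -> - q (- x) <= q x.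
Proof.
move=> sq; have := sq.1 x (- x); rewrite subrr (sublinear0 sq).
by rewrite -lerBlDr sub0r.
Qed.

(** The support function of the face of [q] on which evaluation at [x] is
    maximal. *)
Let shift q x : V -> R :=
  fun z => inf [set q (z + t *: x) - t * q x | t in [set t : R | 0 <= t]].

Let shift_lb q x z : sublinear q ->
  lbound [set q (z + t *: x) - t * q x | t in [set t : R | 0 <= t]] (- q (- z)).
Proof.
move=> sq _ [t /= t0 <-].
have : q (t *: x) = t * q x.
  move: t0; rewrite le_eqVlt => /predU1P[<-|/sq.2 //].
  by rewrite scale0r mul0r sublinear0.
have := sq.1 (z + t *: x) (- z); rewrite addrAC subrr add0r; lra.
Qed.

Let shift_le q x z t : sublinear q -> 0 <= t ->
  shift q x z <= q (z + t *: x) - t * q x.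
Proof.
by move=> sq t0; apply: ge_inf; [exists (- q (- z)); exact: shift_lb|exists t].
Qed.

Let shift_ge q x z r : (forall t, 0 <= t -> r <= q (z + t *: x) - t * q x) ->
  r <= shift q x z.
Proof.
move=> h; apply: lb_le_inf; first by exists (q (z + 0 *: x) - 0 * q x), 0 => /=.
by move=> _ [t /= t0 <-]; exact: h.
Qed.

Let shift_sublinear q x : sublinear q -> sublinear (shift q x).
Proof.
move=> sq; split.
  move=> y z; rewrite -lerBlDr; apply: shift_ge => t t0.
  rewrite lerBlDr -lerBlDl; apply: shift_ge => s s0; rewrite lerBlDl.
  apply: (le_trans (shift_le x (y + z) sq (addr_ge0 t0 s0))).
  have := sq.1 (y + t *: x) (z + s *: x); rewrite addrACA -scalerDl; lra.
have le a z : 0 < a -> shift q x (a *: z) <= a * shift q x z.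
  move=> a0; rewrite -ler_pdivrMl//; apply: shift_ge => t t0.
  rewrite ler_pdivrMl//; apply: (le_trans (shift_le x _ sq (mulr_ge0 (ltW a0) t0))).
  by rewrite -scalerA -scalerDr sq.2// mulrBr mulrA.
move=> a z a0; apply/eqP; rewrite eq_le le//=.
have a1 : 0 < a^-1 by rewrite invr_gt0.
have := le _ (a *: z) a1; rewrite scalerA mulVf ?gt_eqF// scale1r.
by rewrite ler_pdivlMl.
Qed.

(** If a combination of [f] and [g] lies below the shift, testing it at [- x]
    forces [f x = q x = g x], and this equality gives both bounds. *)
Let shift_face p q x : supporting_face p q -> supporting_face p (shift q x).
Proof.
case=> sq qp ext; have sle z : shift q x z <= q z.
  by have := shift_le x z sq (lexx 0); rewrite scale0r addr0 mul0r subr0.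
split; [exact: shift_sublinear|by move=> z; exact: le_trans (sle z) (qp z)|].
move=> f g t lf lg fp gp t01 fgq.
have [fq gq] := ext f g t lf lg fp gp t01 (fun z => le_trans (fgq z) (sle z)).
have fN (h : V -> R^o) (lh : linear h) z s : h (z + s *: x) = h z + s * h x.
  by rewrite addrC lh addrC.
have : t * f (- x) + (1 - t) * g (- x) <= - q x.
  apply: le_trans (fgq _) _; apply: le_trans (shift_le x _ sq ler01) _.
  by rewrite scale1r addNr sublinear0// sub0r mul1r.
have f0 (h : V -> R^o) (lh : linear h) : h (- x) = - h x.
  have h0 : h 0 = 0.
    have /eqP := lh 1 0 0; rewrite scale1r addr0 scale1r => /eqP E.
    by apply: (@addrI _ (h 0)); rewrite addr0 -E.
  by have := fN h lh 0 (-1); rewrite add0r scaleN1r h0 add0r mulN1r.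
rewrite !f0// => fgx; have := fq x; have := gq x => gx fx.
case/andP: t01 => t0 t1.
have a1 : 0 <= t * (q x - f x) by rewrite mulr_ge0 ?subr_ge0// ltW.
have a2 : 0 <= (1 - t) * (q x - g x) by rewrite mulr_ge0 ?subr_ge0// ltW.
have e1 : t * (q x - f x) = 0 by lra.
have e2 : (1 - t) * (q x - g x) = 0 by lra.
move/eqP: e1; rewrite mulf_eq0 gt_eqF//= subr_eq0 => /eqP qfx.
move/eqP: e2; rewrite mulf_eq0 subr_eq0 gt_eqF//= subr_eq0 => /eqP qgx.
split => z; apply: shift_ge => s s0.
  by have := fq (z + s *: x); rewrite fN// qfx lerBrDr.
by have := gq (z + s *: x); rewrite fN// qgx lerBrDr.
Qed.

Let chain_inf (A : set (V -> R)) : V -> R := fun z => inf [set q z | q in A].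

(** The compactness half of the argument: along a chain the infimum remains
    subadditive because two members of the chain can be compared. *)
Lemma supporting_face_inf p (A : set (V -> R)) : A !=set0 ->
  A `<=` supporting_face p ->
  (forall q r, A q -> A r -> (forall z, q z <= r z) \/ (forall z, r z <= q z)) ->
  supporting_face p (chain_inf A).
Proof.
move=> [q0 Aq0] Af tot.
have sub q : A q -> sublinear q by move=> /Af[].
have Inle q z : A q -> chain_inf A z <= q z.
  move=> Aq; apply: ge_inf; last by exists q.
  exists (- p (- z)) => _ [r Ar <-]; have [sr rp _] := Af _ Ar.
  by rewrite (le_trans _ (sublinear_geN z sr))// lerN2.
have Inge z r : (forall q, A q -> r <= q z) -> r <= chain_inf A z.
  move=> h; apply: lb_le_inf; first by exists (q0 z), q0.
  by move=> _ [q Aq <-]; exact: h.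
split.
- split.
    move=> y z; rewrite -lerBlDr; apply: (Inge _ _) => q Aq.
    rewrite lerBlDr -lerBlDl; apply: (Inge _ _) => r Ar; rewrite lerBlDl.
    case: (tot _ _ Aq Ar) => qr.
      apply: le_trans (Inle q _ Aq) _; apply: le_trans ((sub _ Aq).1 _ _) _.
      by rewrite lerD2l.
    apply: le_trans (Inle r _ Ar) _; apply: le_trans ((sub _ Ar).1 _ _) _.
    by rewrite lerD2r.
  have le a z : 0 < a -> chain_inf A (a *: z) <= a * chain_inf A z.
    move=> a0; rewrite -ler_pdivrMl//; apply: (Inge _ _) => q Aq.
    by rewrite ler_pdivrMl// -(sub _ Aq).2// Inle.
  move=> a z a0; apply/eqP; rewrite eq_le le//=.
  have a1 : 0 < a^-1 by rewrite invr_gt0.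
  have := le _ (a *: z) a1; rewrite scalerA mulVf ?gt_eqF// scale1r.
  by rewrite ler_pdivlMl.
- by move=> x; apply: le_trans (Inle _ _ Aq0) _; have [_ ->] := Af _ Aq0.
- move=> f g t lf lg fp gp t01 fgq.
  have H q : A q -> (forall x, f x <= q x) /\ (forall x, g x <= q x).
    move=> Aq; have [_ _ ext] := Af _ Aq.
    by apply: (ext f g t) => // x; exact: le_trans (fgq x) (Inle _ _ Aq).
  by split=> x; apply: (Inge _ _) => q /H[].
Qed.

Lemma sublinear_odd_linear q :
  sublinear q -> (forall x, q (- x) <= - q x) -> linear (q : V -> R^o).
Proof.
move=> sq qN.
have qE x : q (- x) = - q x.
  by apply/eqP; rewrite eq_le qN/=; have := sublinear_geN (- x) sq; rewrite opprK.
have qD x y : q (x + y) = q x + q y.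
  apply/eqP; rewrite eq_le sq.1/=.
  by have := sq.1 (- x) (- y); rewrite -opprD !qE; lra.
move=> a x y; rewrite qD; congr +%R.
have [a0|a0|->] := ltgtP a 0; last by rewrite !scale0r sublinear0.
  have := sq.2 (- a) x; rewrite oppr_gt0 => /(_ a0).
  by rewrite scaleNr qE mulNr => /oppr_inj.
exact: sq.2.
Qed.

(** A minimal face [q] equals its shifts in all directions, which forces
    [q (- x) = - q x], hence linearity; a linear face is an extreme point.
    Taking a minimal face inside the one where [w] is maximal gives the
    Hahn-Banach theorem and the Krein-Milman theorem together. *)
Lemma extreme_support p w : sublinear p ->
  exists q : V -> R^o, [/\ linear q, forall x, q x <= p x, q w = p w &
    forall f g (t : R), linear f -> linear g ->
      (forall x, f x <= p x) -> (forall x, g x <= p x) -> 0 < t < 1 ->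
      (forall x, q x = t * f x + (1 - t) * g x) ->
    f = q /\ g = q].
Proof.
move=> sp.
pose F q := supporting_face p q /\ q (- w) <= - p w.
have Fp : F (shift p w).
  split; first by apply: shift_face; split => // f g t _ _ fp gp.
  have := shift_le w (- w) sp ler01.
  by rewrite scale1r addNr sublinear0// sub0r mul1r.
pose T := {q | F q}.
pose le (q r : T) := `[< forall x, sval r x <= sval q x >].
have [q0 max] : exists t : T, forall s : T, le t s -> s = t.
  apply: Zorn => /=.
  - by move=> t; apply/asboolP.
  - move=> r s t /asboolP rs /asboolP st; apply/asboolP => x.
    exact: le_trans (st x) (rs x).
  - move=> [r Fr] [s Fs] /asboolP/= rs /asboolP/= sr; apply: eq_exist.
    by apply/funext => x; apply/eqP; rewrite eq_le rs sr.
  - move=> A tot; have [[r Ar]|A0] := pselect (exists r, A r); last first.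
      by exists (exist _ _ Fp) => s As; exfalso; apply: A0; exists s.
    pose B : set (V -> R) := [set sval s | s in A].
    have Fi : F (chain_inf B).
      split.
        apply: supporting_face_inf; first by exists (sval r), r.
          by move=> _ [[q []] ? ? _ <-].
        move=> _ _ [s As <-] [t At <-].
        by have [/asboolP|/asboolP] := tot _ _ As At; [right|left].
      apply: le_trans (svalP r).2; apply: ge_inf; last by exists (sval r) => //; exists r.
      exists (- p (- - w)) => _ [_ [s As <-] <-]; have [sr rp _] := (svalP s).1.
      by rewrite (le_trans _ (sublinear_geN _ sr))// lerN2.
    exists (exist _ _ Fi) => s As; apply/asboolP => x /=.
    apply: ge_inf; last by exists (sval s) => //; exists s.
    exists (- p (- x)) => _ [_ [t At <-] <-]; have [sr rp _] := (svalP t).1.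
    by rewrite (le_trans _ (sublinear_geN _ sr))// lerN2.
case: q0 max => q [fq qw] max.
have [sq qp ext] := fq.
have qx x : shift q x = q.
  have sle z : shift q x z <= q z.
    by have := shift_le x z sq (lexx 0); rewrite scale0r addr0 mul0r subr0.
  have Fs : F (shift q x) by split; [exact: shift_face|exact: le_trans (sle _) qw].
  by have /(_ (introT (asboolP _) sle))/(congr1 sval) := max (exist _ _ Fs).
have qN x : q (- x) <= - q x.
  have := shift_le x (- x) sq ler01.
  by rewrite qx scale1r addNr sublinear0// sub0r mul1r.
exists q; split => //; first exact: sublinear_odd_linear.
  apply/eqP; rewrite eq_le qp/= -lerN2.
  by have := sublinear_geN (- w) sq; have := qN (- w); rewrite opprK; lra.
move=> f g t lf lg fp gp t01 qE.
have [fq' gq] : (forall x, f x <= q x) /\ (forall x, g x <= q x).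
  by apply: (ext f g t) => // x; rewrite qE.
have eqq (h : V -> R^o) : linear h -> (forall x, h x <= q x) -> h = q.
  move=> lh hq; apply/funext => x; apply/eqP; rewrite eq_le hq/=.
  pose hl := GRing.isLinear.Build R V R^o *:%R h lh.
  pose h' : {linear V -> R^o} := HB.pack h hl.
  have : h' (- x) <= q (- x) := hq (- x).
  by rewrite linearN /=; have := qN x; lra.
by split; exact: eqq.
Qed.

End extreme_support.

(** * Norming functionals and a theorem of Helly *)

Section functionals.
Context {R : realType} (E : normedModType R).

Lemma sublinear_norm : sublinear (fun x : E => `|x|).
Proof.
split; first exact: ler_normD.
by move=> a x a0; rewrite normrZ gtr0_norm.
Qed.

Lemma linear_bounded_dual (q : E -> R^o) M : 0 <= M -> linear q ->
  (forall x, q x <= M * `|x|) ->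
  exists2 f : dual E, f = q :> (E -> R^o) & `|f| <= M.
Proof.
move=> M0 lq qM.
pose h := GRing.isLinear.Build R E R^o *:%R q lq.
pose q' : {linear E -> R^o} := HB.pack q h.
have qnM x : `|q x| <= M * `|x|.
  rewrite ler_norml qM andbT lerNl.
  have : q' (- x) <= M * `|- x| := qM (- x).
  by rewrite linearN normrN.
exists (Blin (bounded_linearP lq qnM)) => //.
apply: opnorm_le => x x1; apply: le_trans (qnM x) _.
by rewrite ler_piMr.
Qed.

Lemma norming_functional (x : E) : exists2 f : dual E, `|f| <= 1 & f x = `|x|.
Proof.
have [q [lq qn qx _]] := extreme_support x sublinear_norm.
have qn1 y : q y <= 1 * `|y| by rewrite mul1r.
have [f fq f1] := linear_bounded_dual ler01 lq qn1.
by exists f => //; rewrite fq.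
Qed.

Lemma ler_dual (f : dual E) x : f x <= `|f| * `|x|.
Proof. exact: le_trans (ler_norm _) (ler_opnorm f x). Qed.

Lemma dual_norm_approx (f : dual E) (eta : R) : 0 < eta ->
  exists x : E, `|x| <= 1 /\ `|f| - eta < f x.
Proof.
move=> eta0.
have [_ [x /= x1 <-] fx] := sup_adherent eta0 (opnorm_has_sup f).
have [fx0|fx0] := leP 0 (f x); first by exists x; rewrite -(ger0_norm fx0).
exists (- x); split; first by rewrite normrN.
by rewrite linearN -(ltr0_norm fx0).
Qed.

Lemma bidual_embed_norm (x : E) : `|bidual_embed x| = `|x|.
Proof.
apply/eqP; rewrite eq_le bidual_embed_le/=.
have [f f1 <-] := norming_functional x.
by rewrite (le_trans (ler_norm _))// (opnorm_ub (bidual_embed x) f1).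
Qed.

End functionals.

Section helly.
Context {R : realType} (Y : normedModType R) (L K Q : finType).
Variables (e : L -> dual (dual Y)) (y : K -> Y) (c : K -> L -> R) (r : K -> R).
Variables (g : Q -> dual Y) (d : R).
Hypothesis d0 : 0 < d.
Hypothesis er : forall k, `|bidual_embed (y k) + \sum_l c k l *: e l| < r k.

Let r0 k : 0 < r k. Proof. exact: le_lt_trans (normr_ge0 _) (er k). Qed.

Let V : lmodType R := ((K -> Y) * (Q * L -> R^o))%type.

Let feasible (v : V) : set R := [set tau | 0 < tau /\ exists e' : L -> Y,
  (forall k, `|v.1 k + \sum_l c k l *: e' l| <= tau * r k) /\
  (forall m, `|v.2 m + g m.1 (e' m.2)| <= tau * d)].

(** The distance of [v] to the range of [L -> Y], in the gauge that measures
    the [k]-th coordinate by [r k] and the scalar coordinates by [d]. *)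
Let gauge (v : V) : R := inf (feasible v).

Let feasible_lb v : has_lbound (feasible v).
Proof. by exists 0 => t [/ltW]. Qed.

Let feasible_neq0 v : feasible v !=set0.
Proof.
pose t : R := 1 + \sum_k `|v.1 k| / r k + \sum_m `|v.2 m| / d.
have t1 : 0 <= \sum_k `|v.1 k| / r k.
  by apply: sumr_ge0 => k _; rewrite divr_ge0// ltW.
have t2 : 0 <= \sum_m `|v.2 m| / d.
  by apply: sumr_ge0 => k _; rewrite divr_ge0// ltW.
exists t; split; first by rewrite /t; lra.
exists (fun=> 0); split.
  move=> k; rewrite big1 ?addr0 => [|l _]; last by rewrite scaler0.
  rewrite -ler_pdivrMr// /t (bigD1 k)//= in t1 *.
  have : 0 <= \sum_(i | i != k) `|v.1 i| / r i.
    by apply: sumr_ge0 => i _; rewrite divr_ge0// ltW.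
  lra.
move=> m; rewrite linear0 addr0.
rewrite -ler_pdivrMr// /t (bigD1 m)//= in t2 *.
have : 0 <= \sum_(i | i != m) `|v.2 i| / d.
  by apply: sumr_ge0 => i _; rewrite divr_ge0// ltW.
lra.
Qed.

Let gauge_le v t : feasible v t -> gauge v <= t.
Proof. exact/ge_inf/feasible_lb. Qed.

Let gauge_ge v t : (forall s, feasible v s -> t <= s) -> t <= gauge v.
Proof. by move=> h; apply: lb_le_inf => // s; exact: h. Qed.

Let gauge_sublinear : sublinear gauge.
Proof.
split.
  move=> u v; rewrite -lerBlDr; apply: gauge_ge => t [t0 [e1 [e1k e1m]]].
  rewrite lerBlDr -lerBlDl; apply: gauge_ge => s [s0 [e2 [e2k e2m]]].
  rewrite lerBlDl; apply: gauge_le; split; first exact: addr_gt0.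
  exists (fun l => e1 l + e2 l); split=> [k|m].
    under eq_bigr => l _ do rewrite scalerDr.
    rewrite big_split/= addrACA mulrDl.
    by rewrite (le_trans (ler_normD _ _))// lerD.
  by rewrite (linearD (g m.1))/= addrACA mulrDl (le_trans (ler_normD _ _))// lerD.
have le a v : 0 < a -> gauge (a *: v) <= a * gauge v.
  move=> a0; rewrite -ler_pdivrMl//; apply: gauge_ge => t [t0 [e1 [e1k e1m]]].
  rewrite ler_pdivrMl//; apply: gauge_le; split; first exact: mulr_gt0.
  exists (fun l => a *: e1 l); split=> [k|m].
    under eq_bigr => l _ do rewrite scalerA mulrC -scalerA.
    rewrite -scaler_sumr/= -scalerDr normrZ gtr0_norm// -mulrA.
    by rewrite ler_wpM2l// ltW.
  by rewrite (linearZ_LR (g m.1))/= -scalerDr normrZ gtr0_norm// -mulrA ler_wpM2l// ltW.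
move=> a v a0; apply/eqP; rewrite eq_le le//=.
have a1 : 0 < a^-1 by rewrite invr_gt0.
have := le _ (a *: v) a1; rewrite scalerA mulVf ?gt_eqF// scale1r.
by rewrite ler_pdivlMl.
Qed.

(** If no [e'] works, the vector [w] of constants has distance at least one to the
    range of [L -> Y], so a functional [F] of norm one vanishes on that range and
    is at least one at [w].  Applying the [e l] to the vanishing relations
    rewrites [F w] as a sum of the values of the bidual vectors
    [bidual_embed (y k) + sum_l c k l *: e l], which are too small. *)
Lemma helly_goldstine : exists e' : L -> Y,
  (forall k, `|y k + \sum_l c k l *: e' l| < r k) /\
  (forall q l, `|g q (e' l) - e l (g q)| < d).
Proof.
pose w : V := (y, fun m => - e m.2 (g m.1)).
have [w1|w1] := ltP (gauge w) 1.
  have [t [t0 [e' [e'k e'm]]] t1] := inf_lt (feasible_neq0 w) w1.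
  exists e'; split=> [k|q l].
    by rewrite (le_lt_trans (e'k k))// gtr_pMl.
  by rewrite addrC (le_lt_trans (e'm (q, l)))// gtr_pMl.
exfalso.
have [F [lF Fp Fw _]] := extreme_support w gauge_sublinear.
pose h := GRing.isLinear.Build R V R^o *:%R F lF.
pose F' : {linear V -> R^o} := HB.pack F h.
have FD u v : F (u + v) = F u + F v := linearD F' u v.
have FZ a u : F (a *: u) = a * F u := linearZ_LR F' a u.
have FN u : F (- u) = - F u := linearN F' u.
have F0 : F 0 = 0 := linear0 F'.
have FS (I : finType) (s : I -> V) : F (\sum_i s i) = \sum_i F (s i).
  exact: (linear_sum F').
pose sk k (z : Y) : V := ((fun k' => if k' == k then z else 0), (fun=> 0)).
pose sm m (s : R^o) : V := ((fun=> 0), (fun m' => if m' == m then s else 0)).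
have skl k : linear (sk k).
  move=> a u v; congr pair; apply/funext => k' /=; rewrite ?scaler0 ?addr0//.
  change ((if k' == k then a *: u + v else 0) =
     a *: (if k' == k then u else 0) + (if k' == k then v else 0)).
  by case: ifP => // _; rewrite scaler0 addr0.
have sml m : linear (sm m).
  move=> a u v; congr pair; apply/funext => m' /=; rewrite ?scaler0 ?addr0//.
  change ((if m' == m then a *: u + v else 0) =
     a *: (if m' == m then u else 0) + (if m' == m then v else 0)).
  by case: ifP => // _; rewrite scaler0 addr0.
have vE (v : V) : v = \sum_k sk k (v.1 k) + \sum_m sm m (v.2 m).
  have sumE (I : finType) (s : I -> V) :
      \sum_i s i = (\sum_i (s i).1, \sum_i (s i).2).
    by elim/big_rec3: _ => // i a b u _ ->.
  rewrite !sumE; case: v => z s; congr pair; apply/funext => i /=.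
    change (z i = (\sum_k (fun k' => if k' == k then z k else 0)) i +
      (\sum_(m : Q * L) (fun _ : K => 0 : Y)) i).
    rewrite !fct_sumE [X in _ + X]big1// addr0 (bigD1 i)//= eqxx big1 ?addr0// => j ji.
    by rewrite eq_sym (negbTE ji).
  change (s i = (\sum_(k : K) (fun _ : Q * L => 0 : R^o)) i +
      (\sum_(m : Q * L) (fun m' => if m' == m then s m else 0)) i).
  rewrite !fct_sumE [X in X + _]big1// add0r (bigD1 i)//= eqxx big1 ?addr0// => j ji.
  by rewrite eq_sym (negbTE ji).
have FE v : F v = \sum_k F (sk k (v.1 k)) + \sum_m F (sm m (v.2 m)).
  by rewrite {1}(vE v) FD !FS.
have F1 v : (forall k, `|v.1 k| <= r k) -> (forall m, `|v.2 m| <= d) -> F v <= 1.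
  move=> vk vm; apply: le_trans (Fp v) _; apply: gauge_le; split => //.
  exists (fun=> 0); split=> [k|m].
    by rewrite big1 ?addr0 ?mul1r// => l _; rewrite scaler0.
  by rewrite linear0 addr0 mul1r.
have [f fE] : exists f : K -> dual Y, forall k z, f k z = F (sk k z).
  suff /choice[f fE] k : exists f : dual Y, forall z, f z = F (sk k z) by exists f.
  have lf : linear (fun z => F (sk k z) : R^o) by move=> a u v; rewrite skl lF.
  have skZ a z : sk k (a *: z) = a *: sk k z.
    congr pair; apply/funext => i /=; rewrite ?scaler0//.
    change ((if i == k then a *: z else 0) = a *: (if i == k then z else 0)).
    by case: ifP => // _; rewrite scaler0.
  have bf z : F (sk k z) <= (r k)^-1 * `|z|.
    have [->|z0] := eqVneq z 0.
      by rewrite -[X in sk k X](scale0r 0) skZ scale0r F0 normr0 mulr0.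
    have nz : 0 < r k / `|z| by rewrite divr_gt0 ?normr_gt0.
    rewrite -[leRHS]mul1r -ler_pdivrMr; last by rewrite mulr_gt0 ?invr_gt0 ?normr_gt0.
    rewrite invfM invrK mulrC.
    rewrite -FZ -skZ.
    apply: F1 => [k'|m] /=; last by rewrite normr0 ltW.
    case: eqP => [->|_]; last by rewrite normr0 ltW.
    rewrite normrZ (gtr0_norm nz) -mulrA mulVf ?mulr1 ?lexx//.
    by rewrite normr_eq0.
  have rV : 0 <= (r k)^-1 by rewrite invr_ge0 ltW.
  have [f fE _] := linear_bounded_dual rV lf bf.
  by exists f => z; rewrite fE.
pose t m : R := F (sm m 1).
have tE m s : F (sm m s) = s * t m.
  rewrite -FZ; congr F; congr pair; apply/funext => m' /=.
    by rewrite scaler0.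
  change ((if m' == m then s else 0) = s *: (if m' == m then 1 else 0 : R^o)).
  by case: ifP => _; rewrite ?scaler0//= /GRing.scale/= mulr1.
pose A (e' : L -> Y) : V := (fun k => \sum_l c k l *: e' l, fun m => g m.1 (e' m.2)).
have FA e' : F (A e') <= 0.
  apply/ler_addgt0Pr => eps eps0; rewrite add0r; apply: le_trans (Fp _) _.
  apply: gauge_le; split=> //; exists (fun l => - e' l); split=> [k|m] /=.
    rewrite -big_split big1/= ?normr0 ?mulr_ge0// ?ltW// => l _.
    by rewrite scalerN subrr.
  by rewrite (linearN (g m.1)) subrr normr0 mulr_ge0// ltW.
have FA0 e' : F (A e') = 0.
  apply/eqP; rewrite eq_le FA/= -oppr_le0 -FN.
  rewrite (_ : - A e' = A (fun l => - e' l)) ?FA//; congr pair; apply/funext => i /=.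
    change (- (\sum_l c i l *: e' l) = \sum_l c i l *: - e' l).
    by rewrite -sumrN; apply: eq_bigr => l _; rewrite scalerN.
  by rewrite (linearN (g i.1)).
have single (U : lmodType R) (l : L) (x : U) (a : L -> R) :
    \sum_l' a l' *: (if l' == l then x else 0) = a l *: x.
  rewrite (bigD1 l)//= eqxx big1 ?addr0// => j /negbTE ->.
  by rewrite scaler0.
have Fl l : \sum_k c k l *: f k + \sum_q t (q, l) *: g q = 0.
  apply: blinP => x; have := FA0 (fun l' => if l' == l then x else 0).
  rewrite FE /=; under eq_bigr => k _ do rewrite single -fE (linearZ_LR (f k)).
  under [X in _ + X]eq_bigr => m _ do rewrite tE mulrC.
  rewrite -(pair_bigA _ (fun q l' => t (q, l') * g q (if l' == l then x else 0)))/=.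
  have -> : \sum_q \sum_l' t (q, l') * g q (if l' == l then x else 0) =
            \sum_q t (q, l) * g q x.
    apply: eq_bigr => q _; rewrite -[RHS](single R^o l (g q x) (fun l => t (q, l))).
    by apply: eq_bigr => l' _; case: ifP => // _; rewrite linear0.
  move=> S0; apply: etrans S0.
  have sumE (I : finType) (s : I -> dual Y) : (\sum_i s i) x = \sum_i s i x.
    by elim/big_rec2: _ => // i a b _ <-.
  change ((\sum_k c k l *: f k) x + (\sum_q t (q, l) *: g q) x =
     \sum_k c k l *: f k x + \sum_q t (q, l) * g q x).
  by rewrite !sumE.
(* Applying [e l] to the relations and summing over [l]. *)
pose E k := bidual_embed (y k) + \sum_l c k l *: e l.
have FwE : F w = \sum_k E k (f k).
  rewrite FE /=.
  have -> : \sum_m F (sm m (- e m.2 (g m.1))) = \sum_k \sum_l c k l * e l (f k).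
    under eq_bigr => m _ do rewrite tE.
    rewrite -(pair_bigA _ (fun q l => - e l (g q) * t (q, l)))/=.
    rewrite exchange_big [RHS]exchange_big; apply: eq_bigr => l _.
    have eZ (u : dual Y) a : e l (a *: u) = a * e l u := linearZ_LR (e l) a u.
    have := congr1 (e l) (Fl l).
    rewrite linear0 linearD !linear_sum => /eqP; rewrite addr_eq0 => /eqP eS.
    transitivity (- \sum_q t (q, l) * e l (g q)).
      by rewrite -sumrN; apply: eq_bigr => q _; rewrite mulNr mulrC.
    under [in LHS]eq_bigr => q _ do rewrite -eZ.
    by rewrite -[LHS]eS; apply: eq_bigr => k _; rewrite -eZ.
  rewrite -big_split/=; apply: eq_bigr => k _; rewrite -fE.
  have sumE (s : L -> dual (dual Y)) x : (\sum_i s i) x = \sum_i s i x.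
    by elim/big_rec2: _ => // i a b _ <-.
  change (f k (y k) + \sum_l c k l * e l (f k) =
          f k (y k) + (\sum_l c k l *: e l) (f k)).
  by rewrite sumE.
have fr : \sum_k r k * `|f k| <= 1.
  apply/ler_addgt0Pr => eps eps0.
  pose eta := eps / (1 + \sum_k r k).
  have rs : 0 <= \sum_k r k by apply: sumr_ge0 => k _; exact: ltW.
  have eta0 : 0 < eta by rewrite divr_gt0// ltr_pwDl.
  have /choice[z zE] k := dual_norm_approx (f k) eta0.
  have : F (fun k => r k *: z k, fun=> 0) <= 1.
    apply: F1 => [k|m] /=; last by rewrite normr0 ltW.
    by rewrite normrZ gtr0_norm// ger_pMr// (zE k).1.
  rewrite FE /= [X in _ + X]big1 => [|m _]; last by rewrite tE mul0r.
  rewrite addr0 => F1'.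
  have : \sum_k r k * `|f k| <= \sum_k F (sk k (r k *: z k)) + \sum_k r k * eta.
    rewrite -big_split/=; apply: ler_sum => k _.
    rewrite -fE (linearZ_LR (f k)) -mulrDr ler_wpM2l ?ltW//.
    by rewrite -ltrBlDr (zE k).2.
  move/le_trans; apply; rewrite lerD// -mulr_suml /eta mulrCA ger_pMr//.
  by rewrite ler_pdivrMr ?ltr_pwDl// mul1r lerDr.
have Ef : 1 <= \sum_k `|E k| * `|f k|.
  rewrite (le_trans w1)// -Fw FwE; apply: ler_sum => k _; exact: ler_dual.
have f0 k : f k = 0.
  have s0 : \sum_k (r k - `|E k|) * `|f k| = 0.
    apply/eqP; rewrite eq_le; apply/andP; split; last first.
      by apply: sumr_ge0 => j _; rewrite mulr_ge0// subr_ge0 ltW// er.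
    under eq_bigr => j _ do rewrite mulrBl.
    by rewrite sumrB subr_le0 (le_trans fr).
  have pos j : xpredT j -> 0 <= (r j - `|E j|) * `|f j|.
    by move=> _; rewrite mulr_ge0// subr_ge0 ltW// er.
  have /eqP := s0; rewrite psumr_eq0// => /allP/(_ k (mem_index_enum k))/=.
  by rewrite mulf_eq0 subr_eq0 gt_eqF ?er//= normr_eq0 => /eqP.
by move: Ef; rewrite big1 ?ler10// => k _; rewrite f0 normr0 mulr0.
Qed.

End helly.

(** * Descending from the union of the even duals *)

Section finite_representability.
Context {R : realType}.

(** Local reflexivity in the form of finite systems: every finite system of
    strict norm inequalities with constants in [Y] that is solvable in [Z] is
    solvable in [Y], with prescribed values of functionals up to [d].  Including
    the functionals makes the notion transitive along a chain of biduals. *)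
Definition finitely_represented (Y Z : normedModType R) (J : Y -> Z) :=
  forall (L K Q : finType) (e : L -> Z) (y : K -> Y) (c : K -> L -> R)
    (r : K -> R) (phi : Q -> dual Z) (s : Q -> R) (d : R),
  0 < d -> (forall k, `|J (y k) + \sum_l c k l *: e l| < r k) ->
  (forall q, `|phi q| < s q) ->
  exists (e' : L -> Y) (phi' : Q -> dual Y),
    [/\ forall k, `|y k + \sum_l c k l *: e' l| < r k,
        forall q, `|phi' q| < s q &
        forall q l, `|phi' q (e' l) - phi q (e l)| < d].

Lemma finitely_represented_id (Y : normedModType R) :
  finitely_represented (@id Y).
Proof.
move=> L K Q e y c r phi s d d0 er ps; exists e, phi; split => // q l.
by rewrite subrr normr0.
Qed.

Lemma finitely_represented_comp (Y Z W : normedModType R) (J : Y -> Z)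
    (J' : Z -> W) :
  finitely_represented J -> finitely_represented J' ->
  finitely_represented (J' \o J).
Proof.
move=> YZ ZW L K Q e y c r phi s d d0 er ps.
have d2 : 0 < d / 2 by rewrite divr_gt0.
have [e1 [p1 [er1 ps1 pe1]]] := ZW L K Q e (J \o y) c r phi s _ d2 er ps.
have [e2 [p2 [er2 ps2 pe2]]] := YZ L K Q e1 y c r p1 s _ d2 er1 ps1.
exists e2, p2; split => // q l.
by rewrite (splitr d) (le_lt_trans (ler_distD (p1 q (e1 l)) _ _))// ltrD.
Qed.

(** The functionals on the bidual are first replaced by functionals on [Y], by
    applying [helly_goldstine] to the dual of [Y] with the roles of vectors and
    functionals exchanged; only then are the vectors moved. *)
Lemma finitely_represented_bidual (Y : normedModType R) :
  finitely_represented (@bidual_embed R Y).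
Proof.
move=> L K Q e y c r phi s d d0 er ps.
have d2 : 0 < d / 2 by rewrite divr_gt0.
have delta (U : lmodType R) (u : Q -> U) q : \sum_q' (q == q')%:R *: u q' = u q.
  rewrite (bigD1 q)//= eqxx scale1r big1 ?addr0// => j.
  by rewrite eq_sym => /negbTE ->; rewrite scale0r.
have ps' q : `|bidual_embed (0 : dual Y) + \sum_q' (q == q')%:R *: phi q'| < s q.
  rewrite delta; have -> : bidual_embed (0 : dual Y) = 0.
    by apply: blinP => g; exact: (linear0 g).
  by rewrite add0r.
have [phi' [p's p'e]] := helly_goldstine (e := phi) e d2 ps'.
have [e' [e'r e'p]] := helly_goldstine phi' d2 er.
exists e', phi'; split => // [q|q l].
  by have := p's q; rewrite delta add0r.
by rewrite (splitr d) (le_lt_trans (ler_distD (e l (phi' q)) _ _))// ltrD.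
Qed.

Lemma finite_lower_bound (I : finType) (a : I -> R) : (forall i, 0 < a i) ->
  exists2 b, 0 < b & forall i, b <= a i.
Proof.
move=> a0; exists (\big[Order.min/1]_i a i); last by move=> i; exact: bigmin_le.
by apply: lt_bigmin.
Qed.

End finite_representability.

Section infinite_dual_representability.
Context {R : realType} (X : normedModType R).
Local Notation W := (infinite_dual X).

Lemma even_dual_embed_linear k : linear (@even_dual_embed R X k).
Proof.
move=> a x y; pose s := a *: DualUnion (embedded_tailP x) + DualUnion (embedded_tailP y).
transitivity (completion_embed (union_seminorm X) s); last exact: completion_embed_linear.
rewrite (@even_dual_embed_tail _ _ s k); last first.
  move=> n kn; change (a *: embedded_tail x n.+1 + embedded_tail y n.+1 =
    bidual_embed (a *: embedded_tail x n + embedded_tail y n)).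
  by rewrite bidual_embed_linear !embedded_tailS.
by congr even_dual_embed; rewrite -{1}(embedded_tail_id x) -{1}(embedded_tail_id y).
Qed.

Lemma even_dual_embed_norm k (x : even_dual X k) : `|even_dual_embed x| = `|x|.
Proof.
rewrite completion_embed_norm; apply/cvg_lim => //.
apply: cvg_near_cst; exists k => // n /= kn.
elim: n kn => [|n IHn].
  by rewrite leqn0 => /eqP k0; subst k; rewrite embedded_tail_id.
rewrite leq_eqVlt => /predU1P[kn|kn]; first by subst k; rewrite embedded_tail_id.
by rewrite embedded_tailS// bidual_embed_norm IHn.
Qed.

Lemma even_dual_embed_blin k :
  @even_dual_embed R X k \in @bounded_linear R (even_dual X k) W.
Proof.
apply: (@bounded_linearP _ _ _ _ 1); first exact: even_dual_embed_linear.
by move=> x; rewrite mul1r even_dual_embed_norm.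
Qed.

Fixpoint even_dual_base k : X -> even_dual X k :=
  if k is k'.+1 then @bidual_embed R _ \o @even_dual_base k' else id.

Lemma even_dual_embed_base k x :
  even_dual_embed (even_dual_base k x) = @even_dual_embed R X 0 x.
Proof. by elim: k => //= k <-; rewrite even_dual_embedS. Qed.

Lemma finitely_represented_even_dual k : finitely_represented (even_dual_base k).
Proof.
elim: k => [|k IHk] /=; first exact: finitely_represented_id.
exact/finitely_represented_comp/finitely_represented_bidual.
Qed.

Lemma even_dual_embed_widen k m (u : even_dual X k) : (k <= m)%N ->
  exists u' : even_dual X m, even_dual_embed u' = even_dual_embed u.
Proof.
elim: m => [|m IHm]; first by rewrite leqn0 => /eqP km; subst k; exists u.
rewrite leq_eqVlt => /predU1P[km|/IHm[u' <-]]; first by subst k; exists u.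
by exists (bidual_embed u'); rewrite even_dual_embedS.
Qed.

Lemma even_dual_approx (L : finType) (e : L -> W) (eta : R) : 0 < eta ->
  exists k (u : L -> even_dual X k), forall l, `|e l - even_dual_embed (u l)| < eta.
Proof.
move=> eta0.
have /choice[u uP] l : exists u : {k & even_dual X k},
    `|e l - even_dual_embed (tagged u)| < eta.
  have : closure (\bigcup_k range (@even_dual_embed R X k)) (e l).
    by rewrite even_dual_embed_dense.
  move=> /(_ _ (nbhsx_ballx _ _ eta0))[_ [[k _ [v _ <-]]]].
  by rewrite -ball_normE => ev; exists (existT _ k v).
pose m := \max_l tag (u l).
have /choice[v vE] l := even_dual_embed_widen (tagged (u l)) (@leq_bigmax _ (fun l => tag (u l)) l).
by exists m, v => l; rewrite vE.
Qed.

(** Strict inequalities survive an approximation, so the vectors may be taken in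
    some [even_dual X k], to which the functionals are restricted. *)
Lemma finitely_represented_infinite_dual :
  finitely_represented (@even_dual_embed R X 0).
Proof.
move=> L K Q e y c r phi s d d0 er ps.
pose C k := 1 + \sum_l `|c k l|.
have C0 k : 0 < C k by rewrite ltr_pwDl// sumr_ge0.
pose E k := even_dual_embed (y k) + \sum_l c k l *: e l.
have gap k : 0 < (r k - `|E k|) / C k by rewrite divr_gt0 ?subr_gt0 //; exact: er.
have [eta1 eta10 eta1P] := finite_lower_bound gap.
have gap' q : 0 < d / 2 / (1 + `|phi q|) by rewrite !divr_gt0// ltr_pwDl.
have [eta2 eta20 eta2P] := finite_lower_bound gap'.
have eta0 : 0 < Order.min eta1 eta2 by rewrite lt_min eta10.
have [k [u uP]] := even_dual_approx e eta0.
pose J : blin (even_dual X k) W := Blin (even_dual_embed_blin k).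
have er' i : `|even_dual_base k (y i) + \sum_l c i l *: u l| < r i.
  rewrite -even_dual_embed_norm.
  have -> : even_dual_embed (even_dual_base k (y i) + \sum_l c i l *: u l) =
      E i - \sum_l c i l *: (e l - even_dual_embed (u l)).
    change (J (even_dual_base k (y i) + \sum_l c i l *: u l) =
      E i - \sum_l c i l *: (e l - J (u l))).
    rewrite linearD linear_sum/= even_dual_embed_base /E -addrA; congr +%R.
    rewrite -sumrB; apply: eq_bigr => l _.
    by rewrite -scalerBr opprB addrC subrK; exact: (linearZ_LR J).
  rewrite (le_lt_trans (ler_normB _ _))// -ltrBrDl.
  have : \sum_l `|c i l| * eta1 < r i - `|E i|.
    rewrite -mulr_suml (lt_le_trans _ (_ : C i * eta1 <= _))//.
      by rewrite ltr_pM2r// /C ltrDr.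
    by rewrite -ler_pdivlMl// mulrC.
  apply: le_lt_trans; rewrite (le_trans (ler_norm_sum _ _ _))//.
  apply: ler_sum => l _; rewrite normrZ ler_wpM2l// ltW//.
  by rewrite (lt_le_trans (uP l))// ge_min lexx.
have ps' q : `|adjoint J (phi q)| < s q.
  apply: le_lt_trans (ps q); apply: opnorm_le => x x1.
  by apply: (@opnorm_ub _ _ _ (phi q) (J x)); rewrite /= even_dual_embed_norm.
have d2 : 0 < d / 2 by rewrite divr_gt0.
have [e' [phi' [e'r p's pe]]] :=
  finitely_represented_even_dual d2 er' ps'.
exists e', phi'; split => // q l.
rewrite (splitr d) (le_lt_trans (ler_distD (adjoint J (phi q) (u l)) _ _))//.
rewrite ltrD//.
have -> : adjoint J (phi q) (u l) - phi q (e l) = - phi q (e l - J (u l)).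
  by rewrite linearB opprB.
rewrite normrN (le_lt_trans (ler_opnorm _ _))//.
apply: (@le_lt_trans _ _ (`|phi q| * eta2)).
  apply: ler_wpM2l; first exact: opnorm_ge0.
  by apply/ltW/(lt_le_trans (uP l)); rewrite ge_min lexx orbT.
apply: (@lt_le_trans _ _ ((1 + `|phi q|) * eta2)).
  by rewrite ltr_pM2r// ltrDr.
by rewrite -ler_pdivlMl ?ltr_pwDl// mulrC.
Qed.

End infinite_dual_representability.

(** * Multipliers separating extreme points *)

Section multipliers.
Context {R : realType} (W : normedModType R).
Local Notation ext := (extreme_point (@unit_ball R (dual W))).

(** [extreme_support] for the norm: the linear functionals below the norm are
    the points of the dual ball. *)
Lemma extreme_norming (x : W) : exists2 p : dual W, ext p & p x = `|x|.
Proof.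
have [q [lq qn qx qext]] := extreme_support x (sublinear_norm W).
have qn1 y : q y <= 1 * `|y| by rewrite mul1r.
have [p pq p1] := linear_bounded_dual ler01 lq qn1.
exists p; last by rewrite pq.
split=> // f g t f1 g1 t01 pE.
have le1 (u : dual W) : `|u| <= 1 -> forall y, u y <= `|y|.
  by move=> u1 y; rewrite (le_trans (ler_dual u y))// ler_piMl.
have [y|] := qext f g t (blin_linear f) (blin_linear g) (le1 f f1) (le1 g g1) t01.
  by rewrite -pq pE.
by move=> fq gq; split; apply: blinP => y; rewrite pq ?fq ?gq.
Qed.

Lemma extreme_norm1 (p : dual W) : ext p -> p != 0 -> `|p| = 1.
Proof.
move=> [p1 pext] p0; apply/eqP; rewrite eq_le; apply/andP; split; first exact: p1.
rewrite leNgt; apply/negP => p1'.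
have np : 0 < `|p| by rewrite normr_gt0.
have n1 : `|(`|p|^-1 *: p)| = 1 by rewrite normrZ normfV normr_id mulVf ?gt_eqF.
have [||||_ /esym] := pext (`|p|^-1 *: p) 0 `|p|.
- by rewrite /unit_ball/= n1.
- by rewrite /unit_ball/= normr0.
- by rewrite np.
- by rewrite scaler0 addr0 scalerA mulfV ?gt_eqF// scale1r.
by move/eqP; rewrite (negbTE p0).
Qed.

Lemma dualD (p : dual W) x y : p (x + y) = p x + p y.
Proof. exact: linearD. Qed.

Lemma dualZ (p : dual W) a x : p (a *: x) = a * p x.
Proof. exact: (linearZ_LR p). Qed.

Lemma dualN (p : dual W) x : p (- x) = - p x.
Proof. exact: linearN. Qed.

Lemma dual_sum (p : dual W) (I : finType) (A : {pred I}) (x : I -> W) :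
  p (\sum_(i in A) x i) = \sum_(i in A) p (x i).
Proof. exact: linear_sum. Qed.

Lemma blin_scaleE (U : normedModType R) (T : blin W U) a x : (a *: T) x = a *: T x.
Proof. by []. Qed.

(** The eigenvector condition on [T] tested on vectors; it makes sense for
    arbitrary functions and survives composition. *)
Definition multiplier (T : W -> W) :=
  forall p, ext p -> exists a : R, forall x, p (T x) = a * p x.

Lemma centralizer_multiplier T : centralizer W T -> multiplier T.
Proof.
by move=> ZT p /ZT[_ [a aE]]; exists a => x; have := congr1 (fun f : dual W => f x) aE.
Qed.

Lemma multiplier_comb (T S : blin W W) a :
  multiplier T -> multiplier S -> multiplier (a *: T + S).
Proof.
move=> mT mS p ep; have [b bE] := mT p ep; have [c cE] := mS p ep.
exists (a * b + c) => x; rewrite blinE dualD dualZ bE cE.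
by rewrite mulrDl mulrA.
Qed.

Lemma multiplier0 : multiplier (0 : blin W W).
Proof. by move=> p _; exists 0 => x; rewrite mul0r; exact: linear0. Qed.

Lemma multiplier_sum n (T : nat -> blin W W) (c : nat -> R) :
  (forall k, (k < n)%N -> multiplier (T k)) ->
  multiplier (\sum_(k < n) c k *: T k).
Proof.
elim: n => [_|n IHn mT]; first by rewrite big_ord0; exact: multiplier0.
rewrite big_ord_recr/= addrC; apply: multiplier_comb; first exact: mT.
by apply: IHn => k kn; apply: mT; rewrite ltnS ltnW.
Qed.

Lemma blin_sumE (U : normedModType R) (I : finType) (T : I -> blin W U) x :
  (\sum_i T i) x = \sum_i T i x.
Proof. by elim/big_rec2: _ => // i a b _ <-. Qed.

Lemma blin_neq0 (U : normedModType R) (T : blin W U) : T != 0 -> exists x, T x != 0.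
Proof.
move=> T0; have [//|no] := pselect (exists x, T x != 0).
exfalso; move/eqP: T0; apply; apply: blinP => x.
by have [->//|Tx] := eqVneq (T x) 0; case: no; exists x.
Qed.

Hypothesis infZ : ~ finite_dimensional (centralizer W).

Lemma centralizer_out n (T : nat -> blin W W) :
  exists2 S, centralizer W S & forall c : nat -> R, S != \sum_(k < n) c k *: T k.
Proof.
apply: contrapT => no; apply: infZ; exists n, (fun k => T k) => S ZS.
apply: contrapT => noc; apply: no; exists S => // c; apply/eqP => SE.
by apply: noc; exists (fun k => c k).
Qed.

Lemma extreme_neq0 p : ext p -> p != 0.
Proof. by have [S ZS _] := centralizer_out 0 (fun=> 0); move=> /ZS[]. Qed.

(** Subtracting from a multiplier outside the span of the [T k] its values at the
    [p k] leaves a nonzero multiplier that vanishes at all [p k].  It cannot vanish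
    at all extreme points, since these norm [W]. *)
Lemma biorthogonal_multipliers n :
  exists (T : nat -> blin W W) (p : nat -> dual W),
    (forall k, (k < n)%N -> multiplier (T k) /\ ext (p k)) /\
    (forall k l x, (k < n)%N -> (l < n)%N ->
       p l (T k x) = (k == l)%:R * p l x).
Proof.
elim: n => [|n [T [p [Tp Tpd]]]].
  by exists (fun=> 0), (fun=> 0); split=> [k|k l x]; rewrite ltn0.
have [S ZS SN] := centralizer_out n T.
have mS := centralizer_multiplier ZS.
have /choice[c cE] k : exists c : R, (k < n)%N -> forall x, p k (S x) = c * p k x.
  have [kn|] := ltnP k n; last by exists 0.
  by have [c cE] := mS _ (Tp k kn).2; exists c.
pose U := -1 *: (\sum_(k < n) c k *: T k) + S.
have U0 : U != 0.
  by apply: contra (SN c); rewrite /U scaleN1r addrC subr_eq0.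
have mU : multiplier U.
  apply: multiplier_comb => //; apply: multiplier_sum => k kn.
  by have [] := Tp k kn.
have Up l x : (l < n)%N -> p l (U x) = 0.
  move=> ln; rewrite /U blinE dualD dualZ cE// blin_sumE dual_sum.
  rewrite (bigD1 (Ordinal ln))//= ?blin_scaleE dualZ Tpd// eqxx mul1r.
  rewrite big1 ?addr0 => [|k kl]; first by rewrite mulN1r addNr.
  rewrite ?blin_scaleE dualZ Tpd// (_ : (k : nat) == l = false) ?mul0r ?mulr0//.
  by apply: contra_neqF kl => /eqP kl; exact: val_inj.
have [x Ux] := blin_neq0 U0.
have [q eq qx] := extreme_norming (U x).
have [b bE] := mU q eq.
have b0 : b != 0.
  apply: contra Ux => /eqP b0; rewrite -normr_eq0 -qx bE b0.
  by rewrite mul0r.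
have /choice[d dE] k : exists d : R, (k < n)%N -> forall x, q (T k x) = d * q x.
  have [kn|] := ltnP k n; last by exists 0.
  by have [d dE] := (Tp k kn).1 _ eq; exists d.
pose V := b^-1 *: U.
have Vp l z : (l < n)%N -> p l (V z) = 0.
  by move=> ln; rewrite /V blin_scaleE dualZ Up// mulr0.
have Vq z : q (V z) = q z.
  by rewrite /V blin_scaleE dualZ bE mulrA mulVf ?mul1r.
have mV : multiplier V.
  by have := multiplier_comb b^-1 mU multiplier0; rewrite addr0.
exists (fun k => if k == n then V else - d k *: V + T k),
  (fun k => if k == n then q else p k); split.
  move=> k; rewrite ltnS leq_eqVlt; case: eqP => [_ _ //|_ /= kn].
  have [mT ep] := Tp k kn; split => //; exact: (multiplier_comb (- d k) mV mT).
move=> k l z; rewrite !ltnS (leq_eqVlt k) (leq_eqVlt l).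
case: (eqVneq k n) => [->|kn] /= kn'; case: (eqVneq l n) => [->|ln] /= ln'.
- by rewrite ?eqxx Vq mul1r.
- by rewrite Vp// mul0r.
- rewrite (negbTE kn) mul0r ?blinE dualD dualZ Vq dE//.
  by rewrite mulNr addNr.
- by rewrite ?blinE dualD dualZ Vp// mulr0 add0r Tpd.
Qed.

(** A single multiplier separating the points is enough to produce functions
    concentrated at each of them by means of polynomials. *)
Lemma separating_multiplier n :
  exists (T : blin W W) (p : nat -> dual W), multiplier T /\
    forall k, (k < n)%N -> ext (p k) /\ forall x, p k (T x) = k%:R * p k x.
Proof.
have [T [p [Tp Tpd]]] := biorthogonal_multipliers n.
exists (\sum_(k < n) k%:R *: T k), p; split.
  by apply: (@multiplier_sum n T (fun k => k%:R)) => k kn; have [] := Tp k kn.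
move=> l ln; split; first by have [] := Tp l ln.
move=> x; rewrite blin_sumE dual_sum (bigD1 (Ordinal ln))//=.
rewrite ?blin_scaleE dualZ Tpd// eqxx mul1r big1 ?addr0// => k kl.
rewrite ?blin_scaleE dualZ Tpd// (_ : (k : nat) == l = false) ?mul0r ?mulr0//.
by apply: contra_neqF kl => /eqP kl; exact: val_inj.
Qed.

End multipliers.

(** * Partitions into peaks *)

Section peaks.
Context {R : realType}.

Lemma sqr_normE (x : R) : x ^+ 2 = `|x| ^+ 2.
Proof. by rewrite real_normK ?num_real. Qed.

Lemma exists_exprn_le (theta delta : R) : 0 <= theta -> theta < 1 -> 0 < delta ->
  exists n, theta ^+ n <= delta.
Proof.
move=> t0 t1 d0.
have /cvgrPdist_le/(_ _ d0)[n _ /(_ n (leqnn n))] : (fun n => theta ^+ n) @ \oo --> (0 : R).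
  by apply: cvg_expr; rewrite ger0_norm.
by rewrite sub0r normrN ger0_norm ?exprn_ge0// => h; exists n.
Qed.

(** The value at a peak of [x] after the move: [z] is the old value, [v] the value
    of the vector filled in at this peak, [u] that of its companion. *)
Lemma peak_value (t a b u v z : R) : 0 < t -> t <= 1 / 8 -> 0 <= b ->
  a + b <= 1 -> 1 - t <= a -> `|z| <= 1 -> `|u| <= 1 -> 1 - 2 * t < v ->
  1 - 8 * t < (1 - t) * (z + a * (v - z) + b * (u - z)).
Proof.
move=> t0 t8 b0 ab at1 /ler_normlP[z1 z2] /ler_normlP[u1 u2] vt.
have e1 : 0 <= (1 - a - b) * (1 + z) by rewrite mulr_ge0//; lra.
have e2 : 0 <= b * (u + 1) by rewrite mulr_ge0//; lra.
have e3 : 0 <= a * (v - (1 - 2 * t)) by rewrite mulr_ge0//; lra.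
have e4 : 0 <= t * (1 - a) by rewrite mulr_ge0//; lra.
have val : 1 - 4 * t <= z + a * (v - z) + b * (u - z) by lra.
have : (1 - t) * (1 - 4 * t) <= (1 - t) * (z + a * (v - z) + b * (u - z)).
  by rewrite ler_wpM2l//; lra.
by apply: lt_le_trans; nra.
Qed.

Context (W : normedModType R).
Local Notation ext := (extreme_point (@unit_ball R (dual W))).
Hypothesis infZ : ~ finite_dimensional (centralizer W).

(** High powers of the parabolas [1 - (s - k)^2 / M] are bumps around the
    integers.  Any [s] is at distance at least [1 / 2] from all integers but one,
    so at most one bump exceeds [delta]. *)
Lemma bumps_sum (m : nat) (s M theta delta : R) n :
  (forall k : 'I_m, 0 <= 1 - (s - k%:R) ^+ 2 / M <= 1) ->
  1 - 1 / 4 / M <= theta -> 0 < M -> theta ^+ n <= delta -> 0 <= delta ->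
  \sum_(k < m) (1 - (s - k%:R) ^+ 2 / M) ^+ n <= 1 + delta *+ m.
Proof.
move=> b01 tM M0 td d0.
pose b k : R := (1 - (s - k%:R) ^+ 2 / M) ^+ n.
have far (k : 'I_m) : 1 / 2 <= `|s - k%:R| -> b k <= delta.
  move=> sk; apply: le_trans td; rewrite lerXn2r ?nnegrE//.
  - by have /andP[] := b01 k.
  - by have /andP[h _] := b01 k; apply: le_trans h (le_trans _ tM);
      rewrite lerD2l lerN2 ler_pM2r ?invr_gt0// sqr_normE; nra.
  - apply: le_trans tM; rewrite lerD2l lerN2 ler_pM2r ?invr_gt0//.
    by rewrite sqr_normE; nra.
have le1 (k : 'I_m) : b k <= 1.
  by have /andP[b0 b1] := b01 k; rewrite exprn_ile1.
have dm (A : pred 'I_m) : \sum_(k < m | A k) delta <= delta *+ m.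
  by rewrite sumr_const ler_wpMn2l// (leq_trans (max_card _))// card_ord.
have [[k0 near]|no] := pselect (exists k : 'I_m, `|s - k%:R| < 1 / 2); last first.
  apply: (@le_trans _ _ (\sum_(k < m) delta)).
    apply: ler_sum => k _; apply: far; rewrite leNgt; apply/negP => h.
    by apply: no; exists k.
  by rewrite (le_trans (dm _))// lerDr.
rewrite (bigD1 k0)//= lerD ?le1//; apply: le_trans (dm (fun k => k != k0)).
apply: ler_sum => k kk0; apply: far; rewrite leNgt; apply/negP => h.
have : `|(k%:R - k0%:R : R)| < 1.
  rewrite (le_lt_trans (ler_distD s _ _))// [ltRHS]splitr ltrD//.
  by rewrite distrC.
apply/negP; rewrite -leNgt.
have [kl|kl|kl] := ltngtP k k0; last by case/eqP: kk0; exact: val_inj.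
- by rewrite distrC -natrB ?(ltnW kl)// ger0_norm// (ler_nat R 1) subn_gt0.
- by rewrite -natrB ?(ltnW kl)// ger0_norm// (ler_nat R 1) subn_gt0.
Qed.

Lemma multiplier_eigenvalue_le (T : blin W W) p a : ext p ->
  (forall x, p (T x) = a * p x) -> `|a| <= `|T|.
Proof.
move=> ep aE; have p1 := extreme_norm1 ep (extreme_neq0 infZ ep).
have : `|a *: p| <= `|T|.
  apply: opnorm_le => x x1; rewrite -[X in `|X|]/(a * p x) -aE.
  rewrite (le_trans (ler_opnorm p _))// -[opnorm p]/(`|p|) p1 mul1r.
  exact: opnorm_ub.
by rewrite normrZ p1 mulr1.
Qed.

(** The bumps evaluated at [a q], where [a q] is the scalar by which the separating
    multiplier acts at [q], divided by the bound of their sum.  The operator of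
    the [k]-th bump is an iterate of [B k]. *)
Lemma peak_multipliers (m : nat) (eta : R) : 0 < eta ->
  exists (H : 'I_m -> W -> W) (h : 'I_m -> dual W -> R) (p : 'I_m -> dual W),
  [/\ forall q, ext q -> (forall k, 0 <= h k q) /\ \sum_k h k q <= 1,
      forall q, ext q -> forall k x, q (H k x) = h k q * q x &
      forall k, ext (p k) /\ 1 - eta <= h k (p k)].
Proof.
move=> eta0.
have [T [p [mT pT]]] := separating_multiplier infZ m.
have /choice[a aE] q : exists a : R, ext q -> forall x, q (T x) = a * q x.
  have [eq|] := pselect (ext q); last by exists 0.
  by have [a aE] := mT q eq; exists a.
pose N : R := `|T| + m%:R + 1; pose M := N ^+ 2.
have N1 : 1 <= N by rewrite /N lerDr addr_ge0.
have M1 : 1 <= M by rewrite /M exprn_ege1.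
pose theta := 1 - 1 / 4 / M.
have M4 : 0 < 1 / 4 / M by rewrite !divr_gt0// (lt_le_trans ltr01).
have M4' : 1 / 4 / M <= 1 / 4.
  by rewrite ler_pdivrMr ?(lt_le_trans ltr01)//; nra.
pose delta := eta / m.+1%:R.
have delta0 : 0 < delta by rewrite divr_gt0.
have [n nP] : exists n, theta ^+ n <= delta.
  by apply: exists_exprn_le => //; rewrite /theta; lra.
pose b k q : R := 1 - (a q - k%:R) ^+ 2 / M.
pose B k x := x - M^-1 *: (T (T x) - (2 * k%:R) *: T x + k%:R ^+ 2 *: x).
have BE k q x : ext q -> q (B k x) = b k q * q x.
  move=> eq; rewrite /B -scaleN1r dualD !dualZ -(scaleN1r (_ *: _)) !dualD !dualZ.
  rewrite !aE// /b; field.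
  by rewrite gt_eqF// (lt_le_trans ltr01).
pose c := 1 + delta *+ m.
have c1 : 1 <= c by rewrite /c lerDl mulrn_wge0// ltW.
have b01 q : ext q -> forall k : 'I_m, 0 <= b k q <= 1.
  move=> eq k; have aq := multiplier_eigenvalue_le eq (aE q eq).
  have kn : `|a q - k%:R| <= N.
    rewrite (le_trans (ler_normB _ _))// normr_nat /N -addrA lerD//.
    by rewrite natr1 ler_nat ltnW// ltnS ltnW.
  have M0 : 0 < M := lt_le_trans ltr01 M1.
  have s0 : 0 <= (a q - k%:R) ^+ 2 / M by rewrite divr_ge0 ?sqr_ge0// ltW.
  have s1 : (a q - k%:R) ^+ 2 / M <= 1.
    by rewrite ler_pdivrMr// mul1r sqr_normE lerXn2r ?nnegrE// (le_trans ler01).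
  by rewrite /b; apply/andP; split; lra.
exists (fun k x => c^-1 *: iter n (B k) x), (fun k q => c^-1 * b k q ^+ n), p.
have c0 : 0 < c by exact: lt_le_trans ltr01 _.
split.
- move=> q eq; split.
    move=> k; rewrite mulr_ge0 ?invr_ge0 ?exprn_ge0 ?(ltW c0)//.
    by have /andP[] := b01 q eq k.
  rewrite -mulr_sumr ler_pdivrMl// mulr1.
  apply: (bumps_sum (theta := theta)) => //; first exact: b01.
    exact: lt_le_trans ltr01 _.
  exact: ltW.
- move=> q eq k x; rewrite dualZ -mulrA; congr *%R.
  elim: n {nP} => [|n IHn]; first by rewrite expr0 mul1r.
  by rewrite iterS BE// IHn exprS mulrA.
- move=> k; have [ek pk] := pT k (ltn_ord k); split => //.
  have [x px] : exists x, p k x != 0 by apply: blin_neq0; exact: (extreme_neq0 infZ ek).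
  have -> : b k (p k) = 1.
    have : a (p k) * p k x = k%:R * p k x by rewrite -pk -aE.
    move/(mulIf px) => ak; rewrite /b ak subrr expr0n mul0r subr0.
    by [].
  rewrite expr1n mulr1 -[leRHS]mul1r ler_pdivlMr//.
  have : delta *+ m <= eta.
    rewrite /delta -mulr_natr mulrAC -mulrA ger_pMr//.
    by rewrite ler_pdivrMr// mul1r ler_nat.
  have : 0 <= delta *+ m by rewrite mulrn_wge0// ltW.
  rewrite /c; nra.
Qed.


(** The vectors [v i s j] come from [x i] by multiplying it by [1 - h - h'] and
    adding [h w + h' w'] or [h w - h' w'], according to [s], where [h] and [h'] are
    the two peak functions with index [j].  At every extreme point the result of
    any set [S] of such moves is a convex combination of values of norm less than
    one, because the peak functions are nonnegative with sum at most one. *)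
Lemma peaked_perturbations (I : finType) (x : I -> W) (m : nat) (eta : R) :
  0 < eta -> (forall i, `|x i| < 1) ->
  exists (v : I -> bool -> 'I_m -> W) (phi psi : 'I_m -> dual W),
  [/\ forall i s (S : {set 'I_m}),
        `|x i + \sum_(j in S) (v i s j - x i)| < 1,
      forall j, `|phi j| < 1 /\ `|psi j| < 1 &
      forall i s j, 1 - eta < phi j (v i s j) /\
        1 - eta < (-1) ^+ s * psi j (v i s j)].
Proof.
move=> eta0 x1.
pose t := Order.min eta 1 / 8.
have t0 : 0 < t by rewrite divr_gt0// lt_min eta0 ltr01.
have t1 : t <= 1 / 8 by rewrite ler_pM2r ?invr_gt0// ge_min lexx orbT.
have te : 8 * t <= eta.
  by rewrite mulrC divfK ?ge_min ?lexx.
have [H [h [p [h01 pH ph]]]] := peak_multipliers (m + m) t0.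
(* Norms strictly below one leave room for the passage to other spaces. *)
have /choice[w wP] k : exists w : W, `|w| < 1 /\ 1 - 2 * t < p k w.
  have [ek _] := ph k; have pk1 := extreme_norm1 ek (extreme_neq0 infZ ek).
  have [w [w1 pw]] := dual_norm_approx (p k) t0.
  exists ((1 - t / 2) *: w); split.
    by rewrite normrZ ger0_norm; [nra|lra].
  by rewrite dualZ; rewrite pk1 in pw; nra.
have [rho rho1 rhoP] : exists2 rho : R, rho < 1 &
    (forall i, `|x i| <= rho) /\ forall k, `|w k| <= rho.
  have gx i : 0 < 1 - `|x i| by rewrite subr_gt0.
  have gw k : 0 < 1 - `|w k| by rewrite subr_gt0 (wP k).1.
  have [b1 b10 b1P] := finite_lower_bound gx.
  have [b2 b20 b2P] := finite_lower_bound gw.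
  exists (1 - Order.min b1 b2); first by rewrite ltrBlDr ltrDl lt_min b10.
  split=> [i|k].
    have := b1P i; have : Order.min b1 b2 <= b1 by rewrite ge_min lexx.
    lra.
  have := b2P k; have : Order.min b1 b2 <= b2 by rewrite ge_min lexx orbT.
  lra.
pose l (j : 'I_m) := lshift m j; pose r (j : 'I_m) := rshift m j.
pose v i (s : bool) j := x i + (H (l j) (w (l j)) - H (l j) (x i)) +
  ((-1) ^+ s *: H (r j) (w (r j)) - H (r j) (x i)).
have vE q i s j : ext q -> q (v i s j) = q (x i) +
    h (l j) q * (q (w (l j)) - q (x i)) + h (r j) q * ((-1) ^+ s * q (w (r j)) - q (x i)).
  by move=> eq; rewrite /v !dualD !dualN dualZ !pH//; ring.
have sgn (s : bool) (y : R) : `|(-1) ^+ s * y| = `|y| by rewrite normrM normr_sign mul1r.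
have hsum q : ext q -> \sum_j (h (l j) q + h (r j) q) <= 1.
  by move=> /h01[_]; rewrite big_split_ord/= big_split.
have qle q (z : W) : ext q -> `|q z| <= `|z|.
  move=> eq; rewrite (le_trans (ler_opnorm q z))// ler_piMl//.
  by have [q1 _] := eq.
exists v, (fun j => (1 - t) *: p (l j)), (fun j => (1 - t) *: p (r j)); split.
- move=> i s S; set y := x i + _.
  have [q eq <-] := extreme_norming y.
  have h0 k := (h01 q eq).1 k.
  apply: le_lt_trans rho1.
  have hS : \sum_(j in S) (h (l j) q + h (r j) q) <= 1.
    apply: le_trans (hsum q eq).
    rewrite [leRHS](bigID [in S])/= lerDl sumr_ge0// => j _.
    by rewrite addr_ge0.
  have qx : q (x i) <= rho.
    exact: le_trans (ler_norm _) (le_trans (qle q _ eq) (rhoP.1 i)).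
  have qw k : `|q (w k)| <= rho by exact: le_trans (qle q _ eq) (rhoP.2 k).
  have -> : q y = q (x i) + \sum_(j in S) (q (v i s j) - q (x i)).
    rewrite /y dualD dual_sum; congr +%R; apply: eq_bigr => j _.
    by rewrite dualD dualN.
  apply: (@le_trans _ _ (q (x i) + \sum_(j in S) (h (l j) q + h (r j) q) * (rho - q (x i)))).
    rewrite lerD2l; apply: ler_sum => j _; rewrite vE//.
    have a1 : q (w (l j)) <= rho by exact: le_trans (ler_norm _) (qw _).
    have a2 : (-1) ^+ s * q (w (r j)) <= rho.
      by rewrite (le_trans (ler_norm _))// sgn.
    have := ler_wpM2l (h0 (l j)) a1; have := ler_wpM2l (h0 (r j)) a2; lra.
  rewrite -mulr_suml; nra.
- have small k : `|(1 - t) *: p k| < 1.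
    have [ek _] := ph k; have := extreme_norm1 ek (extreme_neq0 infZ ek).
    by rewrite normrZ => ->; rewrite ger0_norm; lra.
  by move=> j.
- move=> i s j.
  have [el hl] := ph (l j); have [er hr] := ph (r j).
  have hlr q : ext q -> h (l j) q + h (r j) q <= 1.
    move=> eq; apply: le_trans (hsum q eq); rewrite (bigD1 j)//= lerDl.
    by apply: sumr_ge0 => k _; rewrite addr_ge0// (h01 q eq).1.
  have xb q : ext q -> `|q (x i)| <= 1.
    by move=> eq; rewrite (le_trans (qle q _ eq))// ltW.
  have wb q k : ext q -> `|q (w k)| <= 1.
    by move=> eq; rewrite (le_trans (qle q _ eq))// ltW// (wP k).1.
  split.
    apply: (@le_lt_trans _ _ (1 - 8 * t)); first lra.
    rewrite blin_scaleE vE//; apply: (peak_value t0 t1 ((h01 _ el).1 (r j))) => //.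
    - exact: hlr.
    - exact: xb.
    - by rewrite sgn; exact: wb.
    - exact: (wP (l j)).2.
  apply: (@le_lt_trans _ _ (1 - 8 * t)); first lra.
  rewrite blin_scaleE vE//.
  have ss : (-1) ^+ s * (-1) ^+ s = 1 :> R by rewrite -expr2 sqrr_sign.
  set a := p (r j) (x i); set y := p (r j) (w (l j)).
  have -> : (-1) ^+ s * ((1 - t) *: (a + h (l j) (p (r j)) * (y - a) +
        h (r j) (p (r j)) * ((-1) ^+ s * p (r j) (w (r j)) - a))) =
      (1 - t) * ((-1) ^+ s * a + h (r j) (p (r j)) * (p (r j) (w (r j)) - (-1) ^+ s * a)
        + h (l j) (p (r j)) * ((-1) ^+ s * y - (-1) ^+ s * a)) :> R.
    rewrite [X in X = _]/(_ * ((1 - t) * _)).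
    move: ((-1) ^+ s) ss (h _ _) (h _ _) (p _ _) => e ee A B z.
    apply/eqP; rewrite -subr_eq0; apply/eqP.
    have -> : e * ((1 - t) * (a + B * (y - a) + A * (e * z - a))) -
        (1 - t) * (e * a + A * (z - e * a) + B * (e * y - e * a)) =
        (1 - t) * A * z * (e * e - 1) by ring.
    by rewrite ee subrr mulr0.
  apply: (peak_value t0 t1 ((h01 _ er).1 (l j))) => //.
  - by rewrite addrC; exact: hlr.
  - by rewrite sgn; exact: xb.
  - by rewrite sgn; exact: wb.
  - exact: (wP (r j)).2.
Qed.

End peaks.

(** * Polynomials on the vertices of a cube *)

Section interpolation.
Context {R : realType}.

(** The derivative at [0] of a polynomial of degree at most [N] is a combination,
    independent of the polynomial, of its values at [N + 1] points. *)
Lemma interpolated_slope N : exists g t : 'I_N.+1 -> R,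
  (forall i, 0 <= t i <= 1) /\
  forall k, (k <= N)%N -> \sum_i g i * t i ^+ k = (k == 1)%:R.
Proof.
pose t (i : 'I_N.+1) : R := i%:R / N.+1%:R.
pose V := Vandermonde N.+1 (\row_i t i).
have tinj (i j : 'I_N.+1) : t i = t j -> i = j.
  move/(mulIf (invr_neq0 _)) => /(_ (lt0r_neq0 (ltr0Sn R N))) /eqP.
  by rewrite eqr_nat => /eqP/val_inj.
have Vu : V \in unitmx.
  rewrite unitmxE det_Vandermonde unitfE; apply/prodf_neq0 => i _.
  apply/prodf_neq0 => j ij; rewrite !mxE subr_eq0; apply: contraTneq ij.
  by move=> /tinj ->; rewrite ltnn.
pose e : 'cV[R]_N.+1 := \col_k ((k : nat) == 1%N)%:R.
exists (fun i => (invmx V *m e) i 0), t; split.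
  move=> i; rewrite divr_ge0//= ler_pdivrMr// mul1r ler_nat.
  by rewrite ltnW.
move=> k; rewrite -ltnS => kN.
have := congr1 (fun M : 'cV[R]_N.+1 => M (Ordinal kN) 0) (mulKVmx Vu e).
rewrite !mxE /= => <-; apply: eq_bigr => i _.
by rewrite mulrC !mxE.
Qed.

(** The probability that a random subset containing each [j] independently with
    probability [t] equals [S]. *)
Definition bernoulli_weight m (t : R) (S : {set 'I_m}) : R :=
  \prod_j (if j \in S then t else 1 - t).

Lemma bernoulli_weight_ge0 m t (S : {set 'I_m}) :
  0 <= t <= 1 -> 0 <= bernoulli_weight t S.
Proof.
by case/andP=> t0 t1; apply: prodr_ge0 => j _; case: ifP => _ //; rewrite subr_ge0.
Qed.

Lemma bernoulli_weight_superset m t (U : {set 'I_m}) :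
  \sum_(S : {set 'I_m} | U \subset S) bernoulli_weight t S = t ^+ #|U|.
Proof.
transitivity (\prod_(j < m) (t + (if j \in U then 0 else 1 - t))).
  rewrite bigA_distr/= [LHS]big_mkcond; apply: eq_bigr => S _ /=.
  case: ifPn => [US|/fintype.subsetPn[j jU jS]].
    apply: eq_bigr => j _; case: ifPn => // jS; case: ifP => // jU.
    by rewrite (fintype.subsetP US _ jU) in jS.
  by rewrite (bigD1 j)//= (negbTE jS) jU mul0r.
rewrite (bigID [in U])/= [X in _ * X]big1 ?mulr1 => [|j /negbTE ->]; last by rewrite addrC subrK.
under eq_bigr => j jU do rewrite jU addr0.
by rewrite prodr_const.
Qed.

Lemma bernoulli_weight_sum m t : \sum_(S : {set 'I_m}) bernoulli_weight t S = 1.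
Proof.
rewrite -[RHS](expr0 t) -(cards0 'I_m) -bernoulli_weight_superset.
by apply: eq_bigl => S; rewrite finset.sub0set.
Qed.

(** On the vertices of a cube a polynomial of degree at most [N] is a combination
    of the functions [S |-> (U \subset S)] with [U] of cardinal at most [N].  The
    definition says so dually: it is killed by all weights that kill these
    functions. *)
Definition cube_degree_le (V : lmodType R) N (P : V -> R) :=
  forall m (lam : {set 'I_m} -> R) (x : V) (b : 'I_m -> V),
  (forall U : {set 'I_m}, (#|U| <= N)%N -> \sum_(S : {set 'I_m} | U \subset S) lam S = 0) ->
  \sum_(S : {set 'I_m}) lam S * P (x + \sum_(j in S) b j) = 0.

(** Let [F t] be the mean of [P (x + sum_(j in S) b j)] for a random [S] containing
    each [j] with probability [t].  It is a polynomial of degree at most [N] in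
    [t], bounded by one on the unit interval, and its derivative at [0] is the
    sum of the increments.  The constant does not depend on the number of
    increments, which is the point. *)
Lemma cube_slope_bound N : exists2 C : R, 0 <= C &
  forall (V : lmodType R) (P : V -> R), cube_degree_le N P ->
  forall m x (b : 'I_m -> V),
    (forall S : {set 'I_m}, `|P (x + \sum_(j in S) b j)| <= 1) ->
    `|\sum_j (P (x + b j) - P x)| <= C.
Proof.
have [g [t [t01 gt]]] := interpolated_slope N.
exists (\sum_i `|g i|); first exact: sumr_ge0.
move=> V P Pdeg m x b P1.
pose f (S : {set 'I_m}) := P (x + \sum_(j in S) b j).
(* The weights of the interpolated slope minus the sum of the increments: both
   agree on the functions [S |-> (U \subset S)] with [U] small. *)
pose lam (S : {set 'I_m}) := \sum_i g i * bernoulli_weight (t i) S -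
  \sum_(j < m) ((S == [set j]%SET)%:R - (S == finset.set0)%:R).
have lamE (h : {set 'I_m} -> R) : \sum_S lam S * h S =
    \sum_i g i * (\sum_S bernoulli_weight (t i) S * h S) -
    \sum_j (h [set j]%SET - h finset.set0).
  under eq_bigr => S _ do rewrite mulrBl !mulr_suml.
  rewrite sumrB; congr (_ - _); rewrite exchange_big; apply: eq_bigr => i _ /=.
    by rewrite mulr_sumr; apply: eq_bigr => S _; rewrite mulrA.
  under eq_bigr => S _ do rewrite mulrBl.
  rewrite sumrB; congr (_ - _).
    rewrite (bigD1 [set i]%SET)//= eqxx mul1r big1 ?addr0// => S /negbTE ->.
    by rewrite mul0r.
  rewrite (bigD1 finset.set0)//= eqxx mul1r big1 ?addr0// => S /negbTE ->.
  by rewrite mul0r.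
have lam0 (U : {set 'I_m}) : (#|U| <= N)%N -> \sum_(S : {set 'I_m} | U \subset S) lam S = 0.
  move=> UN.
  have -> : \sum_(S : {set 'I_m} | U \subset S) lam S =
      \sum_(S : {set 'I_m}) lam S * (U \subset S)%:R.
    by rewrite big_mkcond; apply: eq_bigr => S _; case: ifP; rewrite ?mulr1 ?mulr0.
  rewrite lamE.
  under eq_bigr => i _.
    under eq_bigr => S _ do rewrite mulr_natr mulrb.
    rewrite -big_mkcond bernoulli_weight_superset; over.
  rewrite gt// finset.subset0 -cards_eq0.
  have [/eqP/cards1P[j ->]|U1] := eqVneq #|U| 1%N.
    rewrite cards1 (bigD1 j)//= subxx subr0 big1 ?addr0 ?subrr// => k kj.
    by rewrite finset.sub1set inE eq_sym (negbTE kj) subrr.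
  rewrite sub0r big1 ?oppr0// => j _; rewrite finset.subset1 -cards_eq0.
  have -> : (U == [set j]%SET) = false.
    by apply: contra_neqF U1 => /eqP ->; rewrite cards1.
  by rewrite subrr.
have := Pdeg m lam x b lam0; rewrite lamE => /eqP; rewrite subr_eq0 => /eqP.
under [X in _ = X -> _]eq_bigr => j _ do rewrite big_set1 big_set0 addr0.
move=> <-; rewrite (le_trans (ler_norm_sum _ _ _))//; apply: ler_sum => i _.
rewrite normrM ler_piMr// (le_trans (ler_norm_sum _ _ _))//.
rewrite -(bernoulli_weight_sum m (t i)); apply: ler_sum => S _.
by rewrite normrM ger0_norm ?bernoulli_weight_ge0// ler_piMr// bernoulli_weight_ge0.
Qed.

End interpolation.

Section tensor_powers.
Context {R : realType} (N : nat) (X : normedModType R).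

Lemma multilinearD (A : ('I_N -> X) -> R) (mA : multilinear A) i (x : 'I_N -> X) (u v : X) :
  A (dfwith x (i := i) (u + v)) = A (dfwith x (i := i) u) + A (dfwith x (i := i) v).
Proof. by have := mA i x 1 u v; rewrite scale1r mul1r. Qed.

Lemma multilinear0 (A : ('I_N -> X) -> R) (mA : multilinear A) i (x : 'I_N -> X) :
  A (dfwith x (i := i) 0) = 0.
Proof.
have := multilinearD mA i x 0 0; rewrite addr0 => /eqP.
by rewrite -[X in X == _]addr0 => /eqP/addrI.
Qed.

Lemma multilinear_sum (A : ('I_N -> X) -> R) (mA : multilinear A) i (x : 'I_N -> X)
    (I : finType) (B : {pred I}) (u : I -> X) :
  A (dfwith x (i := i) (\sum_(j in B) u j)) = \sum_(j in B) A (dfwith x (i := i) (u j)).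
Proof.
apply: (big_morph (fun v => A (dfwith x (i := i) v))); last exact: multilinear0.
exact: multilinearD.
Qed.

(** Expanding one argument after the other, each choice of [b j] adds at most one
    element to the set [U] that [S] must contain, and there are [N] arguments. *)
Lemma multilinear_cube_degree (A : multilinear_form N X) :
  cube_degree_le N (fun x => A (fun=> x)).
Proof.
have mA : multilinear A by case: A.
move=> m lam x b lam0; pose u (S : {set 'I_m}) := x + \sum_(j in S) b j.
pose slots (s : seq 'I_N) (z : 'I_N -> X) v : 'I_N -> X := fun i => if i \in s then v else z i.
suff main (s : seq 'I_N) : uniq s -> forall (U : {set 'I_m}) z, (#|U| + size s <= N)%N ->
    \sum_(S : {set 'I_m} | U \subset S) lam S * A (slots s z (u S)) = 0.
  have := main (enum 'I_N) (enum_uniq _) finset.set0 (fun=> 0).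
  rewrite cards0 size_enum_ord => /(_ (leqnn _)).
  under eq_bigl => S do rewrite finset.sub0set.
  move=> E; rewrite -[RHS]E; apply: eq_bigr => S _; congr (_ * A _).
  by apply/funext => i; rewrite /slots mem_enum.
elim: s => [|i s IHs] /=.
  move=> _ U z; rewrite addn0 => UN.
  have nilE v : slots [::] z v = z by [].
  under eq_bigr => S _ do rewrite nilE.
  rewrite -mulr_suml.
  by rewrite lam0// mul0r.
move=> /andP[si us] U z Us.
have slotE v w : dfwith (slots s z w) (i := i) v = slots s (dfwith z (i := i) v) w.
  apply/funext => k; rewrite /slots; case: dfwithP => [|k' ik].
    by rewrite (negbTE si) dfwith_in.
  by rewrite dfwith_out.
have consE w : slots (i :: s) z w = dfwith (slots s z w) (i := i) w.
  apply/funext => k; rewrite /slots inE; case: dfwithP => [|k' ik].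
    by rewrite eqxx.
  by rewrite eq_sym (negbTE ik).
under eq_bigr => S _ do rewrite consE {2}/u multilinearD// multilinear_sum// mulrDr.
rewrite big_split/=.
under eq_bigr => S _ do rewrite slotE.
rewrite IHs ?add0r//; last by rewrite (leq_trans _ Us)// leq_add2l.
under eq_bigr => S _ do rewrite mulr_sumr big_mkcond.
rewrite exchange_big big1//= => j _.
rewrite -big_mkcondr/=.
transitivity (\sum_(S : {set 'I_m} | (j |: U)%SET \subset S) lam S *
    A (slots s (dfwith z (i := i) (b j)) (u S))).
  apply: eq_big => [S|S _]; last by rewrite slotE.
  by rewrite finset.subUset finset.sub1set andbC.
rewrite IHs// (leq_trans _ Us)// addnS -addSn leq_add2r.
by rewrite cardsU1; case: (j \notin U); rewrite ?add1n ?add0n// leqW.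
Qed.

Lemma tensor_power_symmetric (x : X) : tensor_power x \in @symmetric_tensor R N X.
Proof.
apply/symmetric_tensorP; exists [:: (1, x)].
by rewrite /tensor_sum big_seq1 scale1r.
Qed.

Definition sym_power (x : X) : symTensor N X := SymTensor (tensor_power_symmetric x).

Local Notation Z := (proj_sym_tensor_product N X).
Local Notation emb := (completion_embed (proj_seminorm N X)).

Definition power (x : X) : Z := emb (sym_power x).

(** The relation holds for every multilinear form, hence between the tensor
    powers themselves, and [f] is linear. *)
Lemma power_cube_degree (f : dual Z) : cube_degree_le N (fun x => f (power x)).
Proof.
move=> m lam x b lam0.
pose u (S : {set 'I_m}) := x + \sum_(j in S) b j.
pose h := GRing.isLinear.Build R _ _ *:%R emb (completion_embed_linear (proj_seminorm N X)).
pose e : {linear symTensor N X -> Z} := HB.pack emb h.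
transitivity (f (e (\sum_(S : {set 'I_m}) lam S *: sym_power (u S)))).
  rewrite linear_sum dual_sum; apply: eq_bigr => S _.
  by rewrite linearZ dualZ.
have -> : \sum_(S : {set 'I_m}) lam S *: sym_power (u S) = 0.
  apply: val_inj; rewrite /=; apply/funext => A.
  have valE (I : finType) (s : I -> symTensor N X) :
      symTensor_val (\sum_i s i) A = \sum_i symTensor_val (s i) A.
    by elim/big_rec2: _ => // i a c _ <-.
  have valZ a (s : symTensor N X) :
      symTensor_val (a *: s) A = a * symTensor_val s A by [].
  rewrite [LHS]valE; under eq_bigr => S _ do rewrite valZ.
  exact: (@multilinear_cube_degree A _ lam x b lam0).
by rewrite !linear0.
Qed.

Lemma power_norm x : `|power x| <= `|x| ^+ N.
Proof.
rewrite completion_embed_norm (le_trans (@proj_norm_lb _ _ _ _ [:: (1, x)] _))//=.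
  by rewrite /tensor_sum big_seq1 scale1r.
by rewrite /rep_cost big_seq1 normr1 mul1r.
Qed.

End tensor_powers.

(** * Duality for tensor powers *)

Section power_duality.
Context {R : realType} (N : nat) (X : normedModType R).
Local Notation Z := (proj_sym_tensor_product N X).
Local Notation emb := (completion_embed (proj_seminorm N X)).

Lemma bernoulli_inequality (a : R) n : 0 <= a <= 1 -> 1 - a *+ n <= (1 - a) ^+ n.
Proof.
move=> /andP[a0 a1]; elim: n => [|n IHn]; first by rewrite mulr0n subr0 expr0.
rewrite exprS mulrS; have an : 0 <= a *+ n by rewrite mulrn_wge0.
have : (1 - a) * (1 - a *+ n) <= (1 - a) * (1 - a) ^+ n by rewrite ler_wpM2l// subr_ge0.
by apply: le_trans; nra.
Qed.

Lemma multilinear_diagZ (A : ('I_N -> X) -> R) (mA : multilinear A) a x :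
  A (fun=> a *: x) = a ^+ N * A (fun=> x).
Proof.
suff main (s : seq 'I_N) : uniq s ->
    A (fun i => if i \in s then a *: x else x) = a ^+ size s * A (fun=> x).
  have := main (enum 'I_N) (enum_uniq _); rewrite size_enum_ord => <-.
  by congr A; apply/funext => i; rewrite mem_enum.
elim: s => [|i s IHs] /=; first by rewrite expr0 mul1r.
move=> /andP[si us]; rewrite exprS -mulrA -IHs//.
set z : 'I_N -> X := fun i => if i \in s then a *: x else x.
have zE (v : X) : dfwith z (i := i) v = fun k => if k == i then v else z k.
  apply/funext => k; case: dfwithP => [|k' ik]; first by rewrite eqxx.
  by rewrite eq_sym (negbTE ik).
have := mA i z a x 0; rewrite addr0 multilinear0// addr0 !zE.
have -> : (fun k => if k == i then x else z k) = z.
  by apply/funext => k; case: eqP => // ->; rewrite /z (negbTE si).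
move=> <-; congr A; apply/funext => k; rewrite inE.
by case: eqP.
Qed.

Lemma powerZ a (x : X) : power N (a *: x) = a ^+ N *: power N x.
Proof.
have lin : linear emb by exact: completion_embed_linear.
have emb0 : emb 0 = 0.
  have := lin 1 0 0; rewrite !scale1r addr0 => /eqP.
  by rewrite -[X in X == _]addr0 => /eqP/addrI.
rewrite -[RHS]addr0 -emb0 -lin addr0; congr emb; apply: val_inj.
apply/funext => -[A mA] /=; exact: multilinear_diagZ.
Qed.

Lemma emb_tensor_sum (u : symTensor N X) s :
  u = tensor_sum s :> (multilinear_form N X -> R^o) ->
  emb u = \sum_(a <- s) a.1 *: power N a.2.
Proof.
pose h := GRing.isLinear.Build R _ _ *:%R emb (completion_embed_linear (proj_seminorm N X)).
pose e : {linear symTensor N X -> Z} := HB.pack emb h.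
move=> us; rewrite -[emb]/(e : _ -> _).
have -> : u = \sum_(a <- s) a.1 *: sym_power N a.2.
  apply: val_inj; rewrite /= us /tensor_sum.
  have -> : symTensor_val (\sum_(a <- s) a.1 *: sym_power N a.2) =
      \sum_(a <- s) symTensor_val (a.1 *: sym_power N a.2).
    by elim/big_rec2: _ => // a y1 y2 _ <-.
  by apply: eq_bigr.
by rewrite linear_sum; apply: eq_bigr => a _; rewrite linearZ.
Qed.

(** The unit ball of the projective norm is the closed absolutely convex hull of
    the powers of the points of the ball, so powers determine the norm of [f]. *)
Lemma dual_norm_power (f : dual Z) c : 0 < c ->
  (forall x : X, `|f (power N x)| <= c * `|x| ^+ N) -> `|f| <= c.
Proof.
move=> c0 fc.
have femb u : `|f (emb u)| <= c * `|emb u|.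
  rewrite completion_embed_norm -ler_pdivrMl//; apply: proj_norm_ge => s us.
  rewrite ler_pdivrMl// (emb_tensor_sum us) linear_sum/=.
  rewrite (le_trans (ler_norm_sum _ _ _))// /rep_cost mulr_sumr; apply: ler_sum => a _.
  by rewrite dualZ normrM mulrCA ler_wpM2l.
apply: opnorm_le => z z1; apply: le_trans (_ : c * `|z| <= _); last by rewrite ler_piMr// ltW.
apply/ler_addgt0Pr => eps eps0.
have cf : 0 < c + `|f| by rewrite ltr_pwDl.
have d0 : 0 < eps / (c + `|f|) by rewrite divr_gt0.
have : closure (range emb) z by rewrite completion_embed_dense.
move=> /(_ _ (nbhsx_ballx _ _ d0))[_ [[u _ <-]]].
rewrite -ball_normE /= => zu.
have h1 : `|f z| <= `|f (emb u)| + `|f| * `|z - emb u|.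
  have {1}-> : z = emb u + (z - emb u) by rewrite addrC subrK.
  rewrite dualD (le_trans (ler_normD _ _))//.
  by rewrite lerD2l; exact: ler_opnorm.
have h2 : `|emb u| <= `|z| + `|z - emb u|.
  by rewrite -[X in `|X| <= _](subKr z) ler_normB.
have h3 : (c + `|f|) * `|z - emb u| <= eps by rewrite -ler_pdivlMl// mulrC ltW.
have h4 : c * `|emb u| <= c * (`|z| + `|z - emb u|) by rewrite ler_wpM2l// ltW.
have := femb u; lra.
Qed.

(** The point is found in the open ball, since the perturbation argument needs
    room: homogeneity reduces a bound on the ball of radius [rho] to one on the
    unit ball, and [rho] is chosen with [1 - eta / 2 <= rho ^+ N]. *)
Lemma power_norming (f : dual Z) (eta : R) : (0 < N)%N -> `|f| = 1 ->
  0 < eta <= 1 ->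
  exists (x : X) (s : bool), `|x| < 1 /\ 1 - eta < (-1) ^+ s * f (power N x).
Proof.
move=> N0 f1 /andP[eta0 eta1]; apply: contrapT => no.
have small x : `|x| < 1 -> `|f (power N x)| <= 1 - eta.
  move=> x1; rewrite leNgt; apply/negP => fx; apply: no; exists x.
  by exists (f (power N x) < 0); split => //; rewrite -normrEsign.
suff : `|f| <= 1 - eta / 2 by rewrite f1; lra.
apply: dual_norm_power; first lra.
move=> x; have [->|x0] := eqVneq x 0.
  rewrite -(scale0r 0) powerZ dualZ scale0r normr0 normrM expr0n gtn_eqF//=.
  by rewrite normr0 mul0r mulr0.
pose a := eta / 2 / N.+1%:R; pose rho := 1 - a.
have a0 : 0 < a by rewrite !divr_gt0.
have aN : a *+ N <= eta / 2.
  rewrite -mulr_natr /a mulrAC -mulrA ger_pMr ?divr_gt0//.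
  by rewrite ler_pdivrMr// mul1r ler_nat.
have a1 : a <= 1.
  rewrite /a ler_pdivrMr// mul1r.
  by have : 1 <= N.+1%:R :> R by [rewrite ler1n]; lra.
have rN : 1 - eta / 2 <= rho ^+ N.
  have a01 : 0 <= a <= 1 by rewrite (ltW a0).
  by apply: le_trans (bernoulli_inequality N a01); rewrite lerD2l lerN2.
have rho0 : 0 <= rho by rewrite subr_ge0.
have nx : 0 < `|x| by rewrite normr_gt0.
have : `|(rho / `|x|) *: x| < 1.
  by rewrite normrZ normrM normfV normr_id divfK ?gt_eqF// ger0_norm// /rho; lra.
move=> /small; rewrite powerZ dualZ normrM ger0_norm; last first.
  by rewrite exprn_ge0// divr_ge0.
rewrite expr_div_n mulrAC ler_pdivrMr ?exprn_gt0// => h.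
have rN0 : 0 < rho ^+ N by apply: lt_le_trans rN; lra.
rewrite -(ler_pM2l rN0) (le_trans h)// mulrA ler_wpM2r ?exprn_ge0//.
have : (1 - eta / 2) * (1 - eta / 2) <= rho ^+ N * (1 - eta / 2).
  by rewrite ler_wpM2r//; lra.
by apply: le_trans; nra.
Qed.

(** The right-hand side is tested against the product of the [g k], a multilinear
    form bounded by one on the ball, through the representations whose costs
    define the projective norm. *)
Lemma power_sum_norm_ge (I : finType) (a : I -> R) (x : I -> X)
    (g : 'I_N -> dual X) : (forall k, `|g k| <= 1) ->
  \sum_i a i * \prod_k g k (x i) <= `|\sum_i a i *: power N (x i)|.
Proof.
move=> g1; pose A (z : 'I_N -> X) : R := \prod_k g k (z k).
have mA : multilinear A.
  move=> i z b u v; rewrite /A !(bigD1 (P := xpredT) i)//= !dfwith_in dualD dualZ.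
  rewrite mulrDl -mulrA; congr (_ * (_ * _) + _ * _);
    by apply: eq_bigr => k ki; rewrite !dfwith_out// eq_sym.
pose h := GRing.isLinear.Build R _ _ *:%R emb (completion_embed_linear (proj_seminorm N X)).
pose e : {linear symTensor N X -> Z} := HB.pack emb h.
pose u : symTensor N X := \sum_i a i *: sym_power N (x i).
have -> : \sum_i a i *: power N (x i) = emb u.
  rewrite -[emb]/(e : _ -> _) /u linear_sum; apply: eq_bigr => i _.
  by rewrite linearZ.
rewrite completion_embed_norm; apply: proj_norm_ge => s us.
have := congr1 (fun t : multilinear_form N X -> R^o => t (MultilinearForm mA)) us.
have -> : symTensor_val u (MultilinearForm mA) = \sum_i a i * \prod_k g k (x i).
  rewrite /u; elim/big_rec2: _ => // i y1 y2 _ <-.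
  by [].
have -> : tensor_sum s (MultilinearForm mA) = \sum_(b <- s) b.1 * A (fun=> b.2).
  by rewrite /tensor_sum; elim/big_rec2: _ => // b y1 y2 _ <-.
move=> ->; apply: ler_sum => b _; rewrite (le_trans (ler_norm _))// normrM ler_wpM2l//.
rewrite /A normr_prod -[leRHS](_ : \prod_(k < N) `|b.2| = _); last first.
  by rewrite prodr_const card_ord.
apply: ler_prod => k _; rewrite normr_ge0/= (le_trans (ler_opnorm _ _))//.
by rewrite ler_piMl// g1.
Qed.

End power_duality.

(** * Almost maximal points that are far apart *)

Section selection.
Context {R : realType}.

(** The conclusion of [peaked_perturbations] in [X]: it is a finite system of
    inequalities in the unknowns [v i s j], with constants made of the [x i]. *)
Lemma transferred_perturbations (X : normedModType R) (m : nat) (I : finType)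
    (x : I -> X) (eta : R) :
  ~ finite_dimensional (centralizer (infinite_dual X)) ->
  0 < eta -> (forall i, `|x i| < 1) ->
  exists (v : I -> bool -> 'I_m -> X) (phi psi : 'I_m -> dual X),
  [/\ forall i s (S : {set 'I_m}),
        `|x i + \sum_(j in S) (v i s j - x i)| < 1,
      forall j, `|phi j| < 1 /\ `|psi j| < 1 &
      forall i s j, 1 - eta < phi j (v i s j) /\
        1 - eta < (-1) ^+ s * psi j (v i s j)].
Proof.
move=> infZ eta0 x1.
pose J := @even_dual_embed R X 0.
have Jx i : `|J (x i)| < 1 by rewrite even_dual_embed_norm.
have eta2 : 0 < eta / 2 by rewrite divr_gt0.
have [v [phi [psi [v1 pp vp]]]] := peaked_perturbations infZ m eta2 Jx.
pose L := (I * bool * 'I_m)%type; pose K := (I * bool * {set 'I_m})%type.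
pose c (k : K) (l : L) : R := ((l.1 == k.1) && (l.2 \in k.2))%:R.
have cE (U : lmodType R) (k : K) (w : L -> U) :
    \sum_l c k l *: w l = \sum_(j in k.2) w (k.1, j).
  transitivity (\sum_(l : L) c k (l.1, l.2) *: w (l.1, l.2)).
    by apply: eq_bigr => -[].
  rewrite -(pair_bigA _ (fun k1 j => c k (k1, j) *: w (k1, j)))/= (bigD1 k.1)//=.
  rewrite [X in _ + X]big1 ?addr0 => [|k1 /negbTE k1k]; last first.
    by apply: big1 => j _; rewrite /c/= k1k scale0r.
  rewrite [RHS]big_mkcond; apply: eq_bigr => j _; rewrite /c/= eqxx/=.
  by case: ifP => _; rewrite ?scale1r ?scale0r.
pose e (l : L) := v l.1.1 l.1.2 l.2.
pose y (k : K) := x k.1.1 - \sum_(j in k.2) x k.1.1.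
pose f (q : 'I_m * bool) := if q.2 then psi q.1 else phi q.1.
have Jlin : linear J by exact: even_dual_embed_linear.
have JB a b : J (a - b) = J a - J b.
  by have := Jlin (-1) b a; rewrite !scaleN1r (addrC a) (addrC (J a)).
have JS (S : {set 'I_m}) a : J (\sum_(j in S) a) = \sum_(j in S) J a.
  apply: (big_morph J) => [a1 a2|]; first by have := Jlin 1 a1 a2; rewrite !scale1r.
  by have := JB 0 0; rewrite !subrr.
have er k : `|J (y k) + \sum_l c k l *: e l| < 1.
  rewrite cE /y JB JS -addrA [X in _ + X]addrC -sumrB /e /=; exact: v1.
have f1 q : `|f q| < 1 by rewrite /f; have [] := pp q.1; case: q.2.
(* Only the values at the [v i s j] are prescribed for the functionals: the [x i]
   enter through the constants [y k]. *)
have [e' [f' [e'r f'1 fe]]] := @finitely_represented_infinite_dual R X L K _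
  e y c (fun=> 1) f (fun=> 1) _ eta2 er f1.
exists (fun i s j => e' (i, s, j)), (fun j => f' (j, false)), (fun j => f' (j, true)).
split=> [i s S|j|i s j].
- have := e'r (i, s, S); rewrite cE /y /= -addrA [X in _ + X]addrC -sumrB; exact.
- by split; exact: f'1.
- have [p1 p2] := vp i s j; split.
    have := fe (j, false) (i, s, j); rewrite /f /e /= ltr_norml => /andP[h _]; lra.
  have := fe (j, true) (i, s, j); rewrite /f /e /= => h.
  have : `|(-1) ^+ s * f' (j, true) (e' (i, s, j)) - (-1) ^+ s * psi j (v i s j)| < eta / 2.
    by rewrite -mulrBr normrM normr_sign mul1r.
  by rewrite ltr_norml => /andP[h' _]; lra.
Qed.

Lemma sum_le_exists_le (m : nat) (D : 'I_m -> R) C : (0 < m)%N ->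
  \sum_j D j <= C -> exists j, D j <= C / m%:R.
Proof.
move=> m0 DC; apply: contrapT => no.
have : C < \sum_j D j.
  have -> : C = \sum_(j < m) C / m%:R.
    by rewrite sumr_const card_ord -[RHS]mulr_natr divfK// pnatr_eq0 -lt0n.
  apply: ltr_sum; first by apply/hasP; exists (Ordinal m0) => //; rewrite mem_index_enum.
  by move=> j _; rewrite ltNge; apply/negP => h; apply: no; exists j.
by rewrite ltNge DC.
Qed.

(** The defects [D i s j], by which moving [x i] decreases its almost maximal
    value, are at least [- eta], and their sum over [j] is bounded independently of
    the number [m] of moves.  For large [m] some move [j] has a small total defect
    over all [i] and [s], hence small defects. *)
Lemma selected_points (X : normedModType R) (N n : nat)
    (f : 'I_n -> dual (proj_sym_tensor_product N X)) (eps : R) :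
  ~ finite_dimensional (centralizer (infinite_dual X)) -> (0 < N)%N ->
  (forall i, `|f i| = 1) -> 0 < eps <= 1 ->
  exists (sg : 'I_n -> bool) (v : 'I_n -> bool -> X) (phi psi : dual X),
  [/\ forall i s, `|v i s| <= 1 /\ 1 - eps < (-1) ^+ sg i * f i (power N (v i s)),
      `|phi| <= 1 /\ `|psi| <= 1 &
      forall i s, 1 - eps < phi (v i s) /\ 1 - eps < (-1) ^+ s * psi (v i s)].
Proof.
move=> infZ N0 f1 /andP[eps0 eps1].
pose P i x : R := f i (power N x).
have P1 i x : `|x| < 1 -> `|P i x| <= 1.
  move=> x1; rewrite (le_trans (ler_opnorm (f i) _))// -[opnorm _]/(`|f i|) f1 mul1r.
  by rewrite (le_trans (power_norm _ _))// exprn_ile1// ltW.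
have sgn (s : bool) (y : R) : `|(-1) ^+ s * y| = `|y| by rewrite normrM normr_sign mul1r.
pose n2 : R := (#|{: 'I_n * bool}|)%:R.
pose eta := eps / 2 / (1 + n2).
have n20 : 0 <= n2 by [].
have eta0 : 0 < eta by rewrite !divr_gt0// ltr_pwDl.
have eta1 : eta <= 1.
  rewrite /eta ler_pdivrMr ?ltr_pwDl// mul1r; lra.
have etaE : eta * (1 + n2) = eps / 2 by rewrite divfK// gt_eqF// ltr_pwDl.
have /choice[x /choice[sg xP]] i := power_norming N0 (f1 i) (introT andP (conj eta0 eta1)).
have [C C0 CP] := @cube_slope_bound R N.
(* Half of [eps] pays for the gap between the suprema and the values at [x i], the
   other half for the mean defect [n2 * C / m]. *)
pose m := (Num.truncn ((eps / 2)^-1 * (n2 * C))).+1.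
have mP : n2 * C / m%:R <= eps / 2.
  rewrite ler_pdivrMr// -ler_pdivrMl ?divr_gt0// ltW//.
  exact: truncnS_gt.
have [v [phi [psi [v1 pp vp]]]] := transferred_perturbations m infZ eps0 (fun i => (xP i).1).
have v1' i s j : `|v i s j| < 1.
  by have := v1 i s [set j]%SET; rewrite big_set1 addrC subrK.
pose D i s j : R := (-1) ^+ sg i * P i (x i) - (-1) ^+ sg i * P i (v i s j).
have DC i s : \sum_j D i s j <= C.
  have := CP _ _ (power_cube_degree (f i)) m (x i) (fun j => v i s j - x i)
    (fun S => P1 i _ (v1 i s S)).
  rewrite -(sgn (~~ sg i)); apply: le_trans; apply: le_trans (ler_norm _).
  rewrite mulr_sumr; apply: ler_sum => j _.
  rewrite [x i + _]addrC subrK -/(P i (x i)) -/(P i _) signrN /D; lra.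
have Dlow i s j : - eta <= D i s j.
  have := (xP i).2; have : (-1) ^+ sg i * P i (v i s j) <= 1.
    by rewrite (le_trans (ler_norm _))// sgn P1.
  rewrite /D -/(P i (x i)); lra.
have [j jP] : exists j, \sum_(k : 'I_n * bool) D k.1 k.2 j <= n2 * C / m%:R.
  apply: sum_le_exists_le => //; rewrite exchange_big/=.
  rewrite (le_trans (ler_sum _ (fun k _ => DC k.1 k.2)))//.
  by rewrite sumr_const -mulr_natl.
exists sg, (fun i s => v i s j), (phi j), (psi j); split.
- move=> i s; split; first by rewrite ltW.
  have : D i s j <= eps / 2 + n2 * eta.
    pose rest : R := \sum_(k : 'I_n * bool | k != (i, s)) D k.1 k.2 j.
    have E : D i s j + rest <= eps / 2.
      by move: jP; rewrite (bigD1 (i, s))//= => /le_trans; apply.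
    have low : - (n2 * eta) <= rest.
      apply: (@le_trans _ _ (\sum_(k : 'I_n * bool | k != (i, s)) - eta)); last first.
        by apply: ler_sum => k _.
      by rewrite sumrN lerN2 sumr_const -mulr_natl ler_wpM2r ?(ltW eta0)// /n2 ler_nat max_card.
    by move: E low; rewrite -lerBrDr => /le_trans E low; apply: E; rewrite lerD2l lerNl.
  have h1 : 1 - eta < (-1) ^+ sg i * P i (x i) := (xP i).2.
  change (D i s j <= eps / 2 + n2 * eta -> 1 - eps < (-1) ^+ sg i * P i (v i s j)).
  by rewrite /D; move: etaE; lra.
- by have [h1 h2] := pp j; rewrite !ltW.
- by move=> i s; exact: vp.
Qed.

End selection.

(** * The strong diameter two property *)

Section strong_diameter.
Context {R : realType}.

Lemma convex_combination_norm_le (Z : normedModType R) n (lambda : 'I_n -> R)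
    (S : 'I_n -> set Z) z :
  (forall i, 0 <= lambda i) -> \sum_i lambda i = 1 -> (forall i, is_slice (S i)) ->
  convex_combination lambda S z -> `|z| <= 1.
Proof.
move=> l0 l1 Sl [x Sx <-]; rewrite (le_trans (ler_norm_sum _ _ _))// -l1.
apply: ler_sum => i _; rewrite normrZ ger0_norm// ler_piMr//.
by have [f [a [_ _ Si]]] := Sl i; have := Sx i; rewrite Si => -[].
Qed.

Lemma diameter_eq2 (Z : normedModType R) (A : set Z) :
  (forall z, A z -> `|z| <= 1) ->
  (forall d, 0 < d -> exists x y, [/\ A x, A y & 2 - d <= `|x - y|]) ->
  diameter A = 2%:E.
Proof.
move=> A1 Ad; apply/eqP; rewrite eq_le; apply/andP; split.
  apply: ge_ereal_sup => _ [x Ax [y Ay <-]]; rewrite lee_fin.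
  by rewrite (le_trans (ler_normB _ _))// (_ : 2 = 1 + 1 :> R)// lerD// A1.
apply/lee_addgt0Pr => d d0; have [x [y [Ax Ay xy]]] := Ad d d0.
rewrite -leeBlDr//; apply: (@le_trans _ _ (`|x - y|%:E)); first by rewrite lee_fin.
by apply: ereal_sup_ubound; exists x => //; exists y.
Qed.

End strong_diameter.

Theorem corollary3p3 (R : realType) (X : completeNormedModType R) :
  ~ finite_dimensional (centralizer (infinite_dual X)) ->
  forall N : nat, (0 < N)%N -> SD2P (proj_sym_tensor_product N X).
Proof.
move=> infZ [//|N] N0 n lambda S l0 l1 Sl.
apply: diameter_eq2 => [z|d d0]; first exact: convex_combination_norm_le.
have /choice[fa faP] i : exists fa : dual (proj_sym_tensor_product N.+1 X) * R,
    [/\ `|fa.1| = 1, 0 < fa.2 & S i = slice fa.1 fa.2].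
  by have [f [a Si]] := Sl i; exists (f, a).
have a0 i : 0 < (fa i).2 by have [] := faP i.
have [al al0 alP] := finite_lower_bound a0.
pose eps := Order.min (Order.min al 1) (d / 2 / N.+1%:R).
have eps0 : 0 < eps by rewrite !lt_min al0 ltr01 !divr_gt0// ltr0n.
have eps1 : eps <= 1 by rewrite !ge_min lexx orbT.
have epsa i : eps <= (fa i).2 by apply: le_trans (alP i); rewrite !ge_min lexx.
have epsN : eps *+ N.+1 <= d / 2.
  by rewrite -[leLHS]mulr_natr -ler_pdivlMr ?ltr0n// !ge_min lexx orbT.
have f1 i : `|(fa i).1| = 1 by have [] := faP i.
have [sg [v [phi [psi [vP [phi1 psi1] phipsi]]]]] :=
  selected_points infZ N0 f1 (introT andP (conj eps0 eps1)).
(* The slice [S i] contains powers up to the sign [sg i] only.  Exchanging the two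
   points when this sign is negative keeps the test form positive at [u]. *)
pose u i : proj_sym_tensor_product N.+1 X := (-1) ^+ sg i *: power N.+1 (v i (sg i)).
pose w i : proj_sym_tensor_product N.+1 X := (-1) ^+ sg i *: power N.+1 (v i (~~ sg i)).
have inS i s : S i ((-1) ^+ sg i *: power N.+1 (v i s)).
  have [v1 fv] := vP i s; have [_ _ ->] := faP i; split.
    by rewrite /unit_ball/= normrZ normr_sign mul1r (le_trans (power_norm _ _))// exprn_ile1.
  by rewrite dualZ (le_lt_trans _ fv)// lerD2l lerN2.
exists (\sum_i lambda i *: u i), (\sum_i lambda i *: w i); split.
- by exists u => // i; exact: inS.
- by exists w => // i; exact: inS.
(* One factor [psi] decides the sign, whatever the parity of the degree. *)
pose g (k : 'I_N.+1) := if val k == 0%N then psi else phi.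
have g1 k : `|g k| <= 1 by rewrite /g; case: ifP.
pose a (k : 'I_n * bool) : R := lambda k.1 * (-1) ^+ k.2.
have uwE : \sum_i lambda i *: u i - \sum_i lambda i *: w i =
    \sum_(k : 'I_n * bool) a k *: power N.+1 (v k.1 k.2).
  rewrite -(pair_bigA _ (fun i (s : bool) => a (i, s) *: power N.+1 (v i s)))/= -sumrB.
  have sE (b : bool) : (-1) ^+ b = (if b then -1 else 1) :> R by case: b.
  apply: eq_bigr => i _; rewrite big_bool /a /u /w /= !sE !scalerA.
  by case: (sg i); rewrite ?mulr1 ?mulrN1 !scaleNr ?opprK// addrC.
rewrite uwE (le_trans _ (power_sum_norm_ge _ _ g1))//.
rewrite -(pair_bigA _ (fun i (s : bool) => a (i, s) * \prod_k g k (v i s)))/=.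
apply: (@le_trans _ _ (\sum_i lambda i * (2 - d))); first by rewrite -mulr_suml l1 mul1r.
apply: ler_sum => i _; rewrite big_bool /a /= -!mulrA -mulrDr ler_wpM2l//.
have big (s : bool) : 1 - d / 2 <= (-1) ^+ s * \prod_k g k (v i s).
  have e0 : 0 <= 1 - eps by rewrite subr_ge0.
  apply: (@le_trans _ _ ((1 - eps) ^+ N.+1)).
    apply: le_trans (bernoulli_inequality N.+1 _); first by rewrite lerD2l lerN2.
    by rewrite (ltW eps0).
  have [phiv psiv] := phipsi i s.
  rewrite big_ord_recl mulrA exprS; apply: ler_pM => //.
  - exact: exprn_ge0.
  - exact: ltW.
  rewrite (eq_bigr (fun=> phi (v i s))) => [|k _]; last by rewrite /g.
  have phi0 : 0 <= phi (v i s) by exact: le_trans e0 (ltW phiv).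
  by rewrite prodr_const card_ord lerXn2r ?nnegrE// ltW.
have := big true; have := big false; lra.
Qed.
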